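(* (ZF + DC + $\mathrm{AC}_{<\mu}$) Let $\mu$ be a singular cardinal such that $\mu=\sup\{\lambda<\mu:\lambda \text{ is a measurable cardinal}\}$. Then for every ordinal $\zeta$ there is $\kappa<\mu$ such that $\mathrm{rk}_D(\zeta)=\zeta$ for every $\kappa$-complete ultrafilter $D$ on some cardinal $<\mu$.
   Context: The base theory is ZF. $\mathrm{AC}_X$ says that every family of non-empty sets indexed by $X$ has a choice function; $\mathrm{AC}_{<\mu}$ says that $\mathrm{AC}_\alpha$ holds for every $\alpha<\mu$. DC is the axiom of dependent choice. A filter $D$ on a set is $\kappa$-complete if the intersection of fewer than $\kappa$ members of $D$ is in $D$. A cardinal $\lambda>\aleph_0$ is measurable if there is a $\lambda$-complete non-principal ultrafilter on $\lambda$. For a filter $D$ on a set $Y$ and functions $f,g:Y\to\mathrm{Ord}$, $g<_D f$ means $\{s\in Y:g(s)<f(s)\}\in D$. The rank $\mathrm{rk}_D(f)\in\mathrm{Ord}\cup\{\infty\}$ is defined by recursion: for an ordinal $\alpha$, $\mathrm{rk}_D(f)=\alpha$ iff $\mathrm{rk}_D(f)\neq\beta$ for all $\beta<\alpha$ and for every $g:Y\to\mathrm{Ord}$ with $g<_D f$ there is $\beta<\alpha$ with $\mathrm{rk}_D(g)=\beta$; $\mathrm{rk}_D(f)=\infty$ if there is no such $\alpha$. For an ordinal $\zeta$, $\mathrm{rk}_D(\zeta)$ denotes the rank of the function on $Y$ that is constantly $\zeta$. *)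

(* Defs.v *)
(* "Provable in ZF" is rendered as "true in every model of first-order ZF".
   A model is an arbitrary type with a binary relation; it need not be
   well-founded or transitive, and the schemas of Separation and Replacement
   range over first-order formulas with parameters only.  All set-theoretic
   notions below are the internal ones of the model. *)

Set Implicit Arguments.
Unset Strict Implicit.

Record set_structure : Type := SetStructure {
  carrier :> Type;
  mem : carrier -> carrier -> Prop
}.

Declare Scope zf_scope.
Delimit Scope zf_scope with zf.
Notation "x ∈ y" := (mem x y) (at level 70, no associativity) : zf_scope.
Notation "x ∉ y" := (~ mem x y) (at level 70, no associativity) : zf_scope.
Open Scope zf_scope.

(* De Bruijn indices: a quantifier binds index 0. *)
Inductive formula : Type :=
| fMem (i j : nat)
| fEq (i j : nat)
| fFalse
| fImp (p q : formula)
| fAnd (p q : formula)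
| fOr (p q : formula)
| fAll (p : formula)
| fEx (p : formula).

Definition scons (M : Type) (x : M) (e : nat -> M) (n : nat) : M :=
  match n with
  | O => x
  | S k => e k
  end.

Fixpoint sat (M : set_structure) (e : nat -> M) (p : formula) : Prop :=
  match p with
  | fMem i j => e i ∈ e j
  | fEq i j => e i = e j
  | fFalse => False
  | fImp p q => sat e p -> sat e q
  | fAnd p q => sat e p /\ sat e q
  | fOr p q => sat e p \/ sat e q
  | fAll p => forall x : M, sat (scons x e) p
  | fEx p => exists x : M, sat (scons x e) p
  end.

(* Classes and class relations: definable with parameters (the values of e). *)
Definition is_class (M : set_structure) (P : M -> Prop) : Prop :=
  exists (p : formula) (e : nat -> M),
    forall x : M, P x <-> sat (scons x e) p.

Definition is_class_relation (M : set_structure) (R : M -> M -> Prop) : Prop :=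
  exists (p : formula) (e : nat -> M),
    forall x y : M, R x y <-> sat (scons x (scons y e)) p.

Definition subset (M : set_structure) (x y : M) : Prop :=
  forall z : M, z ∈ x -> z ∈ y.

Notation "x ⊆ y" := (subset x y) (at level 70, no associativity) : zf_scope.

Definition is_empty (M : set_structure) (x : M) : Prop :=
  forall z : M, z ∉ x.

Definition is_upair (M : set_structure) (u a b : M) : Prop :=
  forall z : M, z ∈ u <-> z = a \/ z = b.

(* p = (a, b) = {{a}, {a, b}} *)
Definition is_opair (M : set_structure) (p a b : M) : Prop :=
  exists u v : M, is_upair u a a /\ is_upair v a b /\ is_upair p u v.

Definition is_succ (M : set_structure) (s x : M) : Prop :=
  forall z : M, z ∈ s <-> z ∈ x \/ z = x.

Definition is_inductive (M : set_structure) (w : M) : Prop :=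
  (exists z : M, is_empty z /\ z ∈ w) /\
  (forall x : M, x ∈ w -> exists s : M, is_succ s x /\ s ∈ w).

Definition is_omega (M : set_structure) (w : M) : Prop :=
  is_inductive w /\ forall v : M, is_inductive v -> w ⊆ v.

Record ZF (M : set_structure) : Prop := {
  zf_extensionality : forall x y : M, (forall z : M, z ∈ x <-> z ∈ y) -> x = y;
  zf_pairing : forall a b : M, exists u : M, is_upair u a b;
  zf_union : forall x : M, exists u : M,
    forall z : M, z ∈ u <-> exists y : M, y ∈ x /\ z ∈ y;
  zf_power : forall x : M, exists y : M, forall z : M, z ∈ y <-> z ⊆ x;
  zf_infinity : exists w : M, is_inductive w;
  zf_foundation : forall x : M, (exists y : M, y ∈ x) ->
    exists y : M, y ∈ x /\ forall z : M, z ∈ x -> z ∉ y;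
  zf_separation : forall P : M -> Prop, is_class P ->
    forall x : M, exists y : M, forall z : M, z ∈ y <-> z ∈ x /\ P z;
  zf_replacement : forall R : M -> M -> Prop, is_class_relation R ->
    forall x : M, (forall a : M, a ∈ x -> exists! b : M, R a b) ->
    exists y : M, forall b : M, b ∈ y <-> exists a : M, a ∈ x /\ R a b
}.

(* (a, b) ∈ r; for a function f, [related f a b] says f(a) = b. *)
Definition related (M : set_structure) (r a b : M) : Prop :=
  exists p : M, is_opair p a b /\ p ∈ r.

Definition is_function_on (M : set_structure) (f X : M) : Prop :=
  (forall p : M, p ∈ f -> exists a b : M, a ∈ X /\ is_opair p a b) /\
  (forall a : M, a ∈ X -> exists! b : M, related f a b).

Definition maps_to (M : set_structure) (f X Z : M) : Prop :=
  is_function_on f X /\ forall a b : M, related f a b -> b ∈ Z.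

Definition is_bijection (M : set_structure) (f X Z : M) : Prop :=
  maps_to f X Z /\
  (forall b : M, b ∈ Z -> exists! a : M, related f a b).

Definition equinumerous (M : set_structure) (X Z : M) : Prop :=
  exists f : M, is_bijection f X Z.

Definition is_transitive (M : set_structure) (x : M) : Prop :=
  forall y : M, y ∈ x -> y ⊆ x.

(* Foundation makes ∈ a well-order on such a set.  The order of the ordinals
   is ∈ (strict) and ⊆ (non-strict). *)
Definition is_ordinal (M : set_structure) (x : M) : Prop :=
  is_transitive x /\ forall y : M, y ∈ x -> is_transitive y.

(* Cardinals are initial ordinals, finite ones included. *)
Definition is_cardinal (M : set_structure) (k : M) : Prop :=
  is_ordinal k /\ forall b : M, b ∈ k -> ~ equinumerous b k.

Definition is_sup (M : set_structure) (m : M) (P : M -> Prop) : Prop :=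
  is_ordinal m /\
  (forall a : M, P a -> a ⊆ m) /\
  (forall b : M, is_ordinal b -> (forall a : M, P a -> a ⊆ b) -> m ⊆ b).

(* An infinite cardinal m with cf(m) < m. *)
Definition is_singular (M : set_structure) (m : M) : Prop :=
  is_cardinal m /\
  (exists w : M, is_omega w /\ w ⊆ m) /\
  exists a f : M, a ∈ m /\ maps_to f a m /\
    forall b : M, b ∈ m -> exists i c : M, related f i c /\ b ⊆ c.

Definition AC_on (M : set_structure) (X : M) : Prop :=
  forall F : M, is_function_on F X ->
    (forall x A : M, related F x A -> exists a : M, a ∈ A) ->
    exists c : M, is_function_on c X /\
      forall x A a : M, related F x A -> related c x a -> a ∈ A.

Definition AC_below (M : set_structure) (m : M) : Prop :=
  forall a : M, a ∈ m -> AC_on a.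

Definition DC (M : set_structure) : Prop :=
  forall A r : M, (exists x : M, x ∈ A) ->
    (forall x : M, x ∈ A -> exists y : M, y ∈ A /\ related r x y) ->
    exists w f : M, is_omega w /\ maps_to f w A /\
      forall n s x y : M, n ∈ w -> is_succ s n ->
        related f n x -> related f s y -> related r x y.

Definition is_filter (M : set_structure) (D Y : M) : Prop :=
  (forall A : M, A ∈ D -> A ⊆ Y) /\
  Y ∈ D /\
  (forall A : M, is_empty A -> A ∉ D) /\
  (forall A B : M, A ∈ D -> A ⊆ B -> B ⊆ Y -> B ∈ D) /\
  (forall A B C : M, A ∈ D -> B ∈ D ->
    (forall s : M, s ∈ C <-> s ∈ A /\ s ∈ B) -> C ∈ D).

Definition is_ultrafilter (M : set_structure) (D Y : M) : Prop :=
  is_filter D Y /\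
  forall A B : M, A ⊆ Y -> (forall s : M, s ∈ B <-> s ∈ Y /\ s ∉ A) ->
    A ∈ D \/ B ∈ D.

Definition is_principal (M : set_structure) (D Y : M) : Prop :=
  exists a : M, a ∈ Y /\ forall A : M, A ∈ D <-> A ⊆ Y /\ a ∈ A.

(* For a cardinal k, |S| < k means that S is equinumerous with some b < k.
   The intersection of S = ∅ is read as Y. *)
Definition is_complete (M : set_structure) (k D Y : M) : Prop :=
  forall S b C : M, (forall A : M, A ∈ S -> A ∈ D) ->
    b ∈ k -> equinumerous b S ->
    (forall s : M, s ∈ C <-> s ∈ Y /\ forall A : M, A ∈ S -> s ∈ A) ->
    C ∈ D.

Definition is_measurable (M : set_structure) (l : M) : Prop :=
  is_cardinal l /\
  (exists w : M, is_omega w /\ w ∈ l) /\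
  exists D : M, is_ultrafilter D l /\ is_complete l D l /\ ~ is_principal D l.

Definition is_ordinal_function (M : set_structure) (f Y : M) : Prop :=
  is_function_on f Y /\ forall s a : M, related f s a -> is_ordinal a.

(* g <_D f *)
Definition lt_mod (M : set_structure) (D Y g f : M) : Prop :=
  exists A : M, A ∈ D /\
    forall s : M, s ∈ A <->
      s ∈ Y /\ exists a b : M, related g s a /\ related f s b /\ a ∈ b.

(* The recursion defining rk_D has proper classes as its stages (g is
   unrestricted off a set in D), so rk_D is a class relation R, with [R f a]
   for rk_D(f) = a.  Since R is definable, induction on the ordinals of the
   model applies to it, so the recursion clause determines R on functions
   Y -> Ord and ordinals; rk_D(f) = ∞ means that no ordinal is R-related to f. *)
Definition is_rank_relation (M : set_structure) (D Y : M)
    (R : M -> M -> Prop) : Prop :=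
  is_class_relation R /\
  forall f a : M, is_ordinal_function f Y -> is_ordinal a ->
    (R f a <->
       (forall b : M, b ∈ a -> ~ R f b) /\
       (forall g : M, is_ordinal_function g Y -> lt_mod D Y g f ->
          exists b : M, b ∈ a /\ R g b)).

Definition rank_is (M : set_structure) (D Y f a : M) : Prop :=
  is_ordinal_function f Y /\ is_ordinal a /\
  exists R : M -> M -> Prop, is_rank_relation D Y R /\ R f a.

Definition is_constant (M : set_structure) (c Y z : M) : Prop :=
  is_function_on c Y /\ forall s : M, s ∈ Y -> related c s z.

(* rk_D(z) = a for an ordinal z; the constant function exists and is unique. *)
Definition rank_const_is (M : set_structure) (D Y z a : M) : Prop :=
  exists c : M, is_constant c Y z /\ rank_is D Y c a.

(* Main.v *)
From Stdlib Require Import Classical Lia.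
Require Import Defs.

(** Write [rank_le D Y f a] for rk_D(f) <= a.  Always rk_D(z) >= z, so only
    rk_D(z) <= z is at stake, and the proof takes a least ordinal z for which
    no k < mu works.

    Let cf be the cofinality of mu.  Some D on Y < mu, complete for families
    indexed by cf and by omega, has rk_D(z) > z; as <_D is well-founded
    ([lt_mod_minimal]), there is g <_D z with rk_D(g) = z
    ([rank_equal_exists]).  For D-almost all s the ordinal g(s) is below z,
    hence has a witness k_s < mu.  Splitting Y into cf pieces according to a
    bound for k_s in a cofinal sequence, one piece is in D, so one l < mu
    bounds k_s for D-almost all s.  Now take E on Z < mu, complete beyond l
    and beyond Y, with rk_E(z) > z.  Then rk_E(g(s)) = g(s) for D-almost all
    s, and exchanging the two ultrafilters gives
      rk_E(z) = rk_E(rk_D(g)) <= rk_D(s |-> rk_E(g(s))) = rk_D(g) = z,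
    a contradiction.

    The exchange inequality is [rank_exchange], in the form
      rk_E(t |-> rk_D(g_t)) <= rk_D(s |-> rk_E(t |-> g_t(s)))
    for a family of functions g_t.  If h' <_E h where h(t) <= rk_D(g_t), choice
    on Z yields g'_t <_D g_t with h'(t) <= rk_D(g'_t).  The completeness of E
    lets one t decide, for all s at once, whether g'_t(s) < g_t(s) holds for
    E-almost all t; hence for D-almost all s the s-th column of the family
    decreases modulo E, so the right-hand side decreases and induction
    applies.

    Everything takes place inside a model that may be ill-founded, so every
    separation, replacement and induction is applied to a property shown to
    be first-order definable; the tactic [definable_tac] does this from the
    shape of the property. *)

Set Implicit Arguments.
Unset Strict Implicit.

(** * Definability *)

Fixpoint prepend (M : Type) (n : nat) (e c : nat -> M) : nat -> M :=
  match n with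
  | O => c
  | S k => scons (e 0) (prepend k (fun i => e (S i)) c)
  end.

(** The variables below n vary; c holds the parameters.  P is given as a
    predicate on environments so that the binders of a formula become
    environment shifts. *)
Definition definable (M : set_structure) (n : nat) (P : (nat -> M) -> Prop) : Prop :=
  exists (p : formula) (c : nat -> M), forall e, P e <-> sat (prepend n e c) p.

Definition term (M : set_structure) (n : nat) (t : (nat -> M) -> M) : Prop :=
  exists (i : nat) (c : nat -> M), forall e, t e = prepend n e c i.

Section Definability.
Context {M : set_structure} (hZF : ZF M).

Fixpoint rename (r : nat -> nat) (p : formula) : formula :=
  let up := fun i => match i with O => O | S k => S (r k) end in
  match p with
  | fMem i j => fMem (r i) (r j)
  | fEq i j => fEq (r i) (r j)
  | fFalse => fFalse
  | fImp p q => fImp (rename r p) (rename r q)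
  | fAnd p q => fAnd (rename r p) (rename r q)
  | fOr p q => fOr (rename r p) (rename r q)
  | fAll p => fAll (rename up p)
  | fEx p => fEx (rename up p)
  end.

Lemma sat_rename (p : formula) : forall (r : nat -> nat) (e e' : nat -> M),
  (forall i, e' (r i) = e i) -> (sat e' (rename r p) <-> sat e p).
Proof.
  induction p; simpl; intros r e e' He.
  - now rewrite !He.
  - now rewrite !He.
  - tauto.
  - now rewrite (IHp1 r e e' He), (IHp2 r e e' He).
  - now rewrite (IHp1 r e e' He), (IHp2 r e e' He).
  - now rewrite (IHp1 r e e' He), (IHp2 r e e' He).
  - split; intros H x; eapply IHp; try apply (H x); intros [|i]; simpl; auto.
  - split; intros [x H]; exists x; eapply IHp; try apply H; intros [|i]; simpl; auto.
Qed.

Fixpoint double (k : nat) : nat :=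
  match k with O => O | S k => S (S (double k)) end.

Fixpoint interleave (c d : nat -> M) (k : nat) : M :=
  match k with
  | O => c 0
  | S O => d 0
  | S (S k) => interleave (fun i => c (S i)) (fun i => d (S i)) k
  end.

Lemma interleave_even k : forall c d, interleave c d (double k) = c k.
Proof. induction k; simpl; intros; auto; now rewrite IHk. Qed.

Lemma interleave_odd k : forall c d, interleave c d (S (double k)) = d k.
Proof.
  induction k; intros; auto.
  change (interleave (fun i => c (S i)) (fun i => d (S i)) (S (double k)) = d (S k)).
  now rewrite IHk.
Qed.

Fixpoint lift_index (r : nat -> nat) (n i : nat) : nat :=
  match n, i with
  | O, i => r i
  | S n, O => O
  | S n, S i => S (lift_index r n i)
  end.

Lemma prepend_lift (r : nat -> nat) (c c' : nat -> M) : (forall i, c' (r i) = c i) ->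
  forall n i e, prepend n e c' (lift_index r n i) = prepend n e c i.
Proof. intros H; induction n; intros [|i] e; simpl; auto. Qed.

(** Connectives combine two formulas over one environment: the parameters are
    interleaved and the formulas renamed accordingly. *)
Lemma definable_merge n (P Q : (nat -> M) -> Prop) :
  definable n P -> definable n Q -> exists p q c,
    (forall e, P e <-> sat (prepend n e c) p) /\ (forall e, Q e <-> sat (prepend n e c) q).
Proof.
  intros (p & c & Hp) (q & d & Hq).
  exists (rename (lift_index double n) p),
    (rename (lift_index (fun i => S (double i)) n) q), (interleave c d).
  split; intros e; [rewrite Hp | rewrite Hq]; symmetry; apply sat_rename;
    intros i; apply prepend_lift; intros j;
    [apply interleave_even | apply interleave_odd].
Qed.

Lemma term_merge n (t u : (nat -> M) -> M) :
  term n t -> term n u -> exists i j c,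
    (forall e, t e = prepend n e c i) /\ (forall e, u e = prepend n e c j).
Proof.
  intros (i & c & Hi) (j & d & Hj).
  exists (lift_index double n i), (lift_index (fun i => S (double i)) n j), (interleave c d).
  split; intros e; [rewrite Hi | rewrite Hj]; symmetry; apply prepend_lift; intros k;
    [apply interleave_even | apply interleave_odd].
Qed.

Lemma term_var n i : i < n -> term n (fun e : nat -> M => e i).
Proof.
  intros H. destruct (zf_infinity hZF) as [x _]. exists i, (fun _ => x).
  revert i H. induction n; intros [|i] H e; simpl; try lia; auto.
  apply (IHn i ltac:(lia) (fun k => e (S k))).
Qed.

Lemma prepend_skip n k (c : nat -> M) : forall e, prepend n e c (n + k) = c k.
Proof. induction n; intros e; simpl; auto. Qed.

Lemma term_const n (x : M) : term n (fun _ => x).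
Proof.
  exists (n + 0), (fun _ => x). intros e. now rewrite prepend_skip.
Qed.

Lemma definable_mem n (t u : (nat -> M) -> M) :
  term n t -> term n u -> definable n (fun e => t e ∈ u e).
Proof.
  intros Ht Hu. destruct (term_merge Ht Hu) as (i & j & c & Hi & Hj).
  exists (fMem i j), c. intros e. rewrite Hi, Hj. reflexivity.
Qed.

Lemma definable_eq n (t u : (nat -> M) -> M) :
  term n t -> term n u -> definable n (fun e => t e = u e).
Proof.
  intros Ht Hu. destruct (term_merge Ht Hu) as (i & j & c & Hi & Hj).
  exists (fEq i j), c. intros e. rewrite Hi, Hj. reflexivity.
Qed.

Lemma definable_False n : definable n (fun _ : nat -> M => False).
Proof.
  destruct (zf_infinity hZF) as [x _].
  exists fFalse, (fun _ => x). intros e. reflexivity.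
Qed.

Lemma definable_imp n (P Q : (nat -> M) -> Prop) :
  definable n P -> definable n Q -> definable n (fun e => P e -> Q e).
Proof.
  intros HP HQ. destruct (definable_merge HP HQ) as (p & q & c & Hp & Hq).
  exists (fImp p q), c. intros e. simpl. rewrite Hp, Hq. reflexivity.
Qed.

Lemma definable_and n (P Q : (nat -> M) -> Prop) :
  definable n P -> definable n Q -> definable n (fun e => P e /\ Q e).
Proof.
  intros HP HQ. destruct (definable_merge HP HQ) as (p & q & c & Hp & Hq).
  exists (fAnd p q), c. intros e. simpl. rewrite Hp, Hq. reflexivity.
Qed.

Lemma definable_or n (P Q : (nat -> M) -> Prop) :
  definable n P -> definable n Q -> definable n (fun e => P e \/ Q e).
Proof.
  intros HP HQ. destruct (definable_merge HP HQ) as (p & q & c & Hp & Hq).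
  exists (fOr p q), c. intros e. simpl. rewrite Hp, Hq. reflexivity.
Qed.

Lemma definable_all n (P : M -> (nat -> M) -> Prop) :
  definable (S n) (fun e => P (e 0) (fun i => e (S i))) ->
  definable n (fun e => forall x, P x e).
Proof.
  intros (p & c & Hp). exists (fAll p), c. intros e. simpl.
  split; intros H x; apply (Hp (scons x e)); apply H.
Qed.

Lemma definable_ex n (P : M -> (nat -> M) -> Prop) :
  definable (S n) (fun e => P (e 0) (fun i => e (S i))) ->
  definable n (fun e => exists x, P x e).
Proof.
  intros (p & c & Hp). exists (fEx p), c. intros e. simpl.
  split; intros [x H]; exists x; apply (Hp (scons x e)); apply H.
Qed.

(** With s e built from terms, this turns the definability of a predicate of its
    first m arguments into that of its instances. *)
Lemma definable_subst m n (P : (nat -> M) -> Prop) (s : (nat -> M) -> nat -> M) :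
  definable m P -> (forall i, i < m -> term n (fun e => s e i)) ->
  definable n (fun e => P (s e)).
Proof.
  intros (p & c & Hp) Hs.
  assert (exists r d, forall k e, prepend n e d (r k) = prepend m (s e) c k)
    as (r & d & Hr).
  { clear p Hp P. revert s Hs. induction m; intros s Hs.
    - exists (fun k => n + k), c. intros k. simpl.
      intros e. apply prepend_skip.
    - destruct (IHm (fun e i => s e (S i))) as (r & d & Hr).
      { intros i Hi. apply (Hs (S i)). lia. }
      destruct (Hs 0 ltac:(lia)) as (j & d' & Hj).
      exists (fun k => match k with
                | O => lift_index (fun i => S (double i)) n j
                | S k => lift_index double n (r k) end), (interleave d d').
      intros [|k] e; simpl.
      + rewrite Hj. apply prepend_lift. intros i; apply interleave_odd.
      + rewrite <- Hr. apply prepend_lift. intros i; apply interleave_even. }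
  exists (rename r p), d. intros e. rewrite Hp. symmetry. apply sat_rename.
  intros i. apply Hr.
Qed.

Lemma definable_not n (P : (nat -> M) -> Prop) :
  definable n P -> definable n (fun e => ~ P e).
Proof. intros H. apply definable_imp; [exact H | apply definable_False]. Qed.

Lemma definable_iff n (P Q : (nat -> M) -> Prop) :
  definable n P -> definable n Q -> definable n (fun e => P e <-> Q e).
Proof. intros HP HQ. now apply definable_and; apply definable_imp. Qed.

Lemma definable_app1 n (Q : M -> Prop) (t : (nat -> M) -> M) :
  definable 1 (fun e => Q (e 0)) -> term n t -> definable n (fun e => Q (t e)).
Proof.
  intros H Ht.
  apply (definable_subst (s := fun e => scons (t e) (fun _ => t e)) H).
  intros [|i] Hi; [exact Ht | lia].
Qed.

Lemma definable_app2 n (Q : M -> M -> Prop) (t u : (nat -> M) -> M) :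
  definable 2 (fun e => Q (e 0) (e 1)) -> term n t -> term n u ->
  definable n (fun e => Q (t e) (u e)).
Proof.
  intros H Ht Hu.
  apply (definable_subst (s := fun e => scons (t e) (fun _ => u e)) H).
  intros [|i] Hi; [exact Ht | exact Hu].
Qed.

Lemma definable_app3 n (Q : M -> M -> M -> Prop) (t u v : (nat -> M) -> M) :
  definable 3 (fun e => Q (e 0) (e 1) (e 2)) -> term n t -> term n u -> term n v ->
  definable n (fun e => Q (t e) (u e) (v e)).
Proof.
  intros H Ht Hu Hv.
  apply (definable_subst (s := fun e => scons (t e) (scons (u e) (fun _ => v e))) H).
  intros [|[|i]] Hi; [exact Ht | exact Hu | exact Hv].
Qed.

Lemma definable_app4 n (Q : M -> M -> M -> M -> Prop) (t u v w : (nat -> M) -> M) :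
  definable 4 (fun e => Q (e 0) (e 1) (e 2) (e 3)) ->
  term n t -> term n u -> term n v -> term n w ->
  definable n (fun e => Q (t e) (u e) (v e) (w e)).
Proof.
  intros H Ht Hu Hv Hw.
  apply (definable_subst
    (s := fun e => scons (t e) (scons (u e) (scons (v e) (fun _ => w e)))) H).
  intros [|[|[|i]]] Hi; [exact Ht | exact Hu | exact Hv | exact Hw].
Qed.

End Definability.

(* The notions treated as primitive; filled in once they are known to be definable. *)
Ltac definable_atom := fail.

Ltac definable_tac :=
  cbv beta;
  lazymatch goal with
  | |- term _ _ =>
      first [ apply term_const
            | match goal with Z : ZF _ |- _ => apply (term_var Z); apply PeanoNat.Nat.ltb_lt; reflexivity end ]
  | |- definable _ (fun e => forall x : carrier _, @?P x e) =>
      apply (@definable_all _ _ P); definable_tac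
  | |- definable _ (fun e => exists x : carrier _, @?P x e) =>
      apply (@definable_ex _ _ P); definable_tac
  | |- definable _ (fun e => @?P e /\ @?Q e) =>
      apply (@definable_and _ _ P Q); definable_tac
  | |- definable _ (fun e => @?P e \/ @?Q e) =>
      apply (@definable_or _ _ P Q); definable_tac
  | |- definable _ (fun e => @?P e <-> @?Q e) =>
      match goal with Z : ZF _ |- _ => apply (@definable_iff _ _ P Q) end; definable_tac
  | |- definable _ (fun e => ~ @?P e) =>
      match goal with Z : ZF _ |- _ => apply (@definable_not _ Z _ P) end; definable_tac
  | |- definable _ (fun e => @?P e -> @?Q e) =>
      apply (@definable_imp _ _ P Q); definable_tac
  | |- definable _ (fun e => mem (@?t e) (@?u e)) =>
      apply (@definable_mem _ _ t u); definable_tac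
  | |- definable _ (fun e => @?t e = @?u e) =>
      apply (@definable_eq _ _ t u); definable_tac
  | |- definable _ (fun _ => False) =>
      match goal with Z : ZF _ |- _ => apply (definable_False Z) end
  | |- definable _ _ =>
      first
        [ definable_atom
        | match goal with
          | H : definable 1 (fun e => ?Q (e 0)) |- definable _ (fun e => ?Q (@?t e)) =>
              apply (definable_app1 (t := t) H)
          | H : definable 2 (fun e => ?Q (e 0) (e 1))
            |- definable _ (fun e => ?Q (@?t e) (@?u e)) =>
              apply (definable_app2 (t := t) (u := u) H)
          | H : definable 3 (fun e => ?Q (e 0) (e 1) (e 2))
            |- definable _ (fun e => ?Q (@?t e) (@?u e) (@?v e)) =>
              apply (definable_app3 (t := t) (u := u) (v := v) H)
          end ]; definable_tac
  end.

Definition large (M : set_structure) (D Y : M) (P : M -> Prop) : Prop :=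
  exists A : M, A ∈ D /\ forall s : M, s ∈ A <-> s ∈ Y /\ P s.

Definition eq_mod (M : set_structure) (D Y g f : M) : Prop :=
  large D Y (fun s => exists a, related g s a /\ related f s a).

(** The greatest fixed point of the recursion for rk_D(f) <= a, with a set r as
    witness.  A coinductive form needs no recursion through proper classes.
    Passing to some h' equal to h modulo D keeps the functions in r bounded. *)
Definition rank_le (M : set_structure) (D Y f a : M) : Prop :=
  exists r : M, related r f a /\
    forall g b : M, related r g b ->
      forall h : M, is_ordinal_function h Y -> lt_mod D Y h g ->
        exists h' c : M, is_ordinal_function h' Y /\ eq_mod D Y h' h /\
          c ∈ b /\ related r h' c.

Section DefinableNotions.
Context {M : set_structure} (hZF : ZF M).

Lemma subset_definable : definable 2 (fun e : nat -> M => e 0 ⊆ e 1).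
Proof. unfold subset. definable_tac. Qed.

Lemma related_definable : definable 3 (fun e : nat -> M => related (e 0) (e 1) (e 2)).
Proof. unfold related, is_opair, is_upair. definable_tac. Qed.

Lemma ordinal_definable : definable 1 (fun e : nat -> M => is_ordinal (e 0)).
Proof. unfold is_ordinal, is_transitive, subset. definable_tac. Qed.

Lemma function_definable : definable 2 (fun e : nat -> M => is_function_on (e 0) (e 1)).
Proof.
  unfold is_function_on, related, is_opair, is_upair, unique. definable_tac.
Qed.

Lemma ordinal_function_definable :
  definable 2 (fun e : nat -> M => is_ordinal_function (e 0) (e 1)).
Proof.
  pose proof function_definable as H.
  unfold is_ordinal_function, is_ordinal, is_transitive, subset, related, is_opair, is_upair.
  definable_tac.
Qed.

Lemma lt_mod_definable :
  definable 4 (fun e : nat -> M => lt_mod (e 0) (e 1) (e 2) (e 3)).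
Proof. unfold lt_mod, related, is_opair, is_upair. definable_tac. Qed.

Lemma eq_mod_definable :
  definable 4 (fun e : nat -> M => eq_mod (e 0) (e 1) (e 2) (e 3)).
Proof. unfold eq_mod, large, related, is_opair, is_upair. definable_tac. Qed.

Lemma rank_le_definable :
  definable 4 (fun e : nat -> M => rank_le (e 0) (e 1) (e 2) (e 3)).
Proof.
  unfold rank_le, is_ordinal_function, is_function_on, unique,
    eq_mod, large, lt_mod, is_ordinal, is_transitive, subset, related, is_opair, is_upair.
  definable_tac.
Qed.

Lemma constant_definable :
  definable 3 (fun e : nat -> M => is_constant (e 0) (e 1) (e 2)).
Proof.
  unfold is_constant, is_function_on, unique, related, is_opair, is_upair.
  definable_tac.
Qed.

Lemma equinumerous_definable :
  definable 2 (fun e : nat -> M => equinumerous (e 0) (e 1)).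
Proof.
  unfold equinumerous, is_bijection, maps_to, is_function_on, unique, related,
    is_opair, is_upair.
  definable_tac.
Qed.

Lemma cardinal_definable : definable 1 (fun e : nat -> M => is_cardinal (e 0)).
Proof.
  pose proof ordinal_definable as H1. pose proof equinumerous_definable as H2.
  unfold is_cardinal. definable_tac.
Qed.

Lemma ultrafilter_definable :
  definable 2 (fun e : nat -> M => is_ultrafilter (e 0) (e 1)).
Proof. unfold is_ultrafilter, is_filter, is_empty, subset. definable_tac. Qed.

Lemma complete_definable :
  definable 3 (fun e : nat -> M => is_complete (e 0) (e 1) (e 2)).
Proof.
  pose proof equinumerous_definable as H. unfold is_complete. definable_tac.
Qed.

End DefinableNotions.

Ltac definable_atom ::=
  match goal with Z : ZF _ |- definable _ ?P =>
    lazymatch P with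
    | fun e => subset (@?t e) (@?u e) =>
        apply (definable_app2 (t := t) (u := u) (subset_definable Z))
    | fun e => related (@?t e) (@?u e) (@?v e) =>
        apply (definable_app3 (t := t) (u := u) (v := v) (related_definable Z))
    | fun e => is_ordinal (@?t e) =>
        apply (definable_app1 (t := t) (ordinal_definable Z))
    | fun e => is_function_on (@?t e) (@?u e) =>
        apply (definable_app2 (t := t) (u := u) (function_definable Z))
    | fun e => is_ordinal_function (@?t e) (@?u e) =>
        apply (definable_app2 (t := t) (u := u) (ordinal_function_definable Z))
    | fun e => lt_mod (@?t e) (@?u e) (@?v e) (@?w e) =>
        apply (definable_app4 (t := t) (u := u) (v := v) (w := w) (lt_mod_definable Z))
    | fun e => eq_mod (@?t e) (@?u e) (@?v e) (@?w e) =>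
        apply (definable_app4 (t := t) (u := u) (v := v) (w := w) (eq_mod_definable Z))
    | fun e => rank_le (@?t e) (@?u e) (@?v e) (@?w e) =>
        apply (definable_app4 (t := t) (u := u) (v := v) (w := w) (rank_le_definable Z))
    | fun e => is_constant (@?t e) (@?u e) (@?v e) =>
        apply (definable_app3 (t := t) (u := u) (v := v) (constant_definable Z))
    | fun e => is_cardinal (@?t e) =>
        apply (definable_app1 (t := t) (cardinal_definable Z))
    | fun e => is_ultrafilter (@?t e) (@?u e) =>
        apply (definable_app2 (t := t) (u := u) (ultrafilter_definable Z))
    | fun e => is_complete (@?t e) (@?u e) (@?v e) =>
        apply (definable_app3 (t := t) (u := u) (v := v) (complete_definable Z))
    | fun e => large (@?t e) (@?u e) _ => unfold large
    end
  end.

(** * Elementary set theory *)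

Section Sets.
Context {M : set_structure} (hZF : ZF M).

Lemma set_ext (x y : M) : (forall z, z ∈ x <-> z ∈ y) -> x = y.
Proof. apply (zf_extensionality hZF). Qed.

Lemma separation (P : M -> Prop) (x : M) : definable 1 (fun e => P (e 0)) ->
  exists y, forall z, z ∈ y <-> z ∈ x /\ P z.
Proof.
  intros (p & c & H). apply (zf_separation hZF). exists p, c.
  intros z. apply (H (fun _ => z)).
Qed.

Lemma replacement (R : M -> M -> Prop) (x : M) :
  definable 2 (fun e => R (e 0) (e 1)) ->
  (forall a, a ∈ x -> exists! b, R a b) ->
  exists y, forall b, b ∈ y <-> exists a, a ∈ x /\ R a b.
Proof.
  intros (p & c & H). apply (zf_replacement hZF). exists p, c.
  intros a b. apply (H (scons a (fun _ => b))).
Qed.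

Lemma singleton_exists (a : M) : exists u, forall z, z ∈ u <-> z = a.
Proof.
  destruct (zf_pairing hZF a a) as [u H]. exists u. intros z. rewrite (H z). tauto.
Qed.

Lemma union2_exists (x y : M) : exists u, forall z, z ∈ u <-> z ∈ x \/ z ∈ y.
Proof.
  destruct (zf_pairing hZF x y) as [v Hv]. destruct (zf_union hZF v) as [u Hu].
  exists u. intros z. rewrite Hu. split.
  - intros (w & Hw & Hz). apply Hv in Hw as [->| ->]; auto.
  - intros [H|H]; [exists x | exists y]; rewrite (Hv _); auto.
Qed.

Lemma succ_exists (x : M) : exists s, is_succ s x.
Proof.
  destruct (singleton_exists x) as [u Hu]. destruct (union2_exists x u) as [s Hs].
  exists s. intros z. now rewrite Hs, Hu.
Qed.

Lemma upair_unique (u v a b : M) : is_upair u a b -> is_upair v a b -> u = v.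
Proof. intros Hu Hv. apply set_ext. intros z. now rewrite (Hu z), (Hv z). Qed.

Lemma opair_exists (a b : M) : exists p, is_opair p a b.
Proof.
  destruct (zf_pairing hZF a a) as [u Hu], (zf_pairing hZF a b) as [v Hv].
  destruct (zf_pairing hZF u v) as [p Hp]. now exists p, u, v.
Qed.

Lemma opair_unique (p q a b : M) : is_opair p a b -> is_opair q a b -> p = q.
Proof.
  intros (u & v & Hu & Hv & Hp) (u' & v' & Hu' & Hv' & Hq).
  rewrite (upair_unique Hu' Hu), (upair_unique Hv' Hv) in Hq.
  exact (upair_unique Hp Hq).
Qed.

Lemma opair_injective (p a b a' b' : M) :
  is_opair p a b -> is_opair p a' b' -> a = a' /\ b = b'.
Proof.
  intros (u & v & Hu & Hv & Hp) (u' & v' & Hu' & Hv' & Hp').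
  assert (a = a') as <-.
  { assert (u ∈ p) as H by (apply Hp; auto). apply Hp' in H as [->| ->].
    - assert (a ∈ u') as H by (apply Hu; auto). apply Hu' in H. tauto.
    - assert (a' ∈ v') as H by (apply Hv'; auto). apply Hu in H as [->| ->]; auto. }
  split; [reflexivity|].
  assert (forall x y v v' u u' : M, is_upair u a a -> is_upair v a x -> is_upair p u v ->
    is_upair u' a a -> is_upair v' a y -> is_upair p u' v' -> x = a \/ x = y) as A.
  { clear. intros x y v v' u u' Hu Hv Hp Hu' Hv' Hp'.
    assert (v ∈ p) as H by (apply Hp; auto).
    assert (x ∈ v) as K by (apply Hv; auto).
    apply Hp' in H as [->| ->].
    - apply Hu' in K; tauto.
    - now apply Hv' in K. }
  pose proof (A b b' v v' u u' Hu Hv Hp Hu' Hv' Hp').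
  pose proof (A b' b v' v u' u Hu' Hv' Hp' Hu Hv Hp). intuition congruence.
Qed.

Lemma related_iff (r p a b : M) : is_opair p a b -> (related r a b <-> p ∈ r).
Proof.
  intros Hp. split.
  - intros (q & Hq & H). now rewrite (opair_unique Hp Hq).
  - intros H. now exists p.
Qed.

Lemma range_exists (r : M) : exists u, forall a b, related r a b -> a ∈ u /\ b ∈ u.
Proof.
  destruct (zf_union hZF r) as [v Hv], (zf_union hZF v) as [u Hu]. exists u.
  intros a b (p & (s & t & Hs & Ht & Hp) & H).
  assert (t ∈ v) as Htv by (apply Hv; exists p; split; [exact H | apply Hp; auto]).
  split; apply Hu; exists t; (split; [exact Htv | apply Ht; auto]).
Qed.

Lemma relation_exists (X Z : M) (Q : M -> M -> Prop) :
  definable 2 (fun e => Q (e 0) (e 1)) ->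
  exists r, (forall a b, related r a b <-> a ∈ X /\ b ∈ Z /\ Q a b) /\
    (forall p, p ∈ r -> exists a b, a ∈ X /\ is_opair p a b).
Proof.
  intros HQ. destruct (union2_exists X Z) as [W HW].
  destruct (zf_power hZF W) as [W1 HW1]. destruct (zf_power hZF W1) as [W2 HW2].
  destruct (separation (P := fun p => exists a b, a ∈ X /\ b ∈ Z /\ is_opair p a b /\ Q a b) W2)
    as [r Hr].
  { unfold is_opair, is_upair. definable_tac. }
  exists r. split.
  - intros a b. destruct (opair_exists a b) as [p Hp].
    rewrite (related_iff r Hp), Hr. split.
    + intros (_ & a' & b' & Ha & Hb & Hp' & H).
      destruct (opair_injective Hp Hp') as [-> ->]. auto.
    + intros (Ha & Hb & H). split; [|now exists a, b].
      apply HW2. intros x Hx. apply HW1. intros y Hy. apply HW.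
      destruct Hp as (u & v & Hu & Hv & Hp).
      apply Hp in Hx as [->| ->]; [apply Hu in Hy | apply Hv in Hy];
        destruct Hy as [->| ->]; auto.
  - intros p Hp. apply Hr in Hp as (_ & a & b & Ha & _ & Hp & _). now exists a, b.
Qed.

Lemma function_exists (X : M) (Q : M -> M -> Prop) :
  definable 2 (fun e => Q (e 0) (e 1)) -> (forall a, a ∈ X -> exists! b, Q a b) ->
  exists f, is_function_on f X /\ forall a b, related f a b <-> a ∈ X /\ Q a b.
Proof.
  intros HQ H. destruct (replacement HQ H) as [Z HZ].
  destruct (relation_exists X Z HQ) as (f & Hf & Hp).
  assert (forall a b, related f a b <-> a ∈ X /\ Q a b) as E.
  { intros a b. rewrite Hf, HZ. split; [tauto|]. intros [Ha Hb]. eauto. }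
  exists f. split; [split|exact E].
  - exact Hp.
  - intros a Ha. destruct (H a Ha) as (b & Hb & U). exists b.
    split; [now apply E|]. intros c Hc. apply U. now apply E in Hc.
Qed.

Lemma function_total (f X a : M) : is_function_on f X -> a ∈ X -> exists b, related f a b.
Proof. intros [_ H] Ha. destruct (H a Ha) as (b & Hb & _). eauto. Qed.

Lemma function_domain (f X a b : M) : is_function_on f X -> related f a b -> a ∈ X.
Proof.
  intros [H _] (p & Hp & Hf). destruct (H p Hf) as (a' & b' & Ha & Hp').
  destruct (opair_injective Hp Hp') as [-> _]. exact Ha.
Qed.

Lemma function_unique (f X a b c : M) :
  is_function_on f X -> related f a b -> related f a c -> b = c.
Proof.
  intros Hf Hb Hc. destruct Hf as [H1 H] eqn:E.
  destruct (H a (function_domain Hf Hb)) as (d & _ & U).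
  now rewrite <- (U b Hb), <- (U c Hc).
Qed.

Lemma function_ext (f g X : M) : is_function_on f X -> is_function_on g X ->
  (forall a b, related f a b <-> related g a b) -> f = g.
Proof.
  intros Hf Hg H. apply set_ext. intros p.
  split; intros Hp; [destruct Hf as [K _] | destruct Hg as [K _]];
    destruct (K p Hp) as (a & b & _ & Hab); apply (related_iff _ Hab);
    apply H; apply (related_iff _ Hab); exact Hp.
Qed.

Lemma functions_exist (X Z : M) : exists F, forall f, f ∈ F <-> maps_to f X Z.
Proof.
  destruct (relation_exists X Z (Q := fun x y => x = x)) as (W & HW & _);
    [definable_tac|].
  destruct (zf_power hZF W) as [F0 HF0].
  destruct (separation (P := fun f => maps_to f X Z) F0) as [F HF];
    [unfold maps_to; definable_tac|].
  exists F. intros f. rewrite HF. split; [tauto|]. intros [Hf Hv].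
  split; [|now split]. apply HF0. intros p Hp.
  destruct Hf as [H _]. destruct (H p Hp) as (a & b & Ha & Hab).
  apply (related_iff _ Hab). apply HW. repeat split; auto.
  apply (Hv a). now apply (related_iff _ Hab).
Qed.

(** * Ordinals *)

Lemma foundation (P : M -> Prop) (x : M) : definable 1 (fun e => P (e 0)) ->
  (exists y, y ∈ x /\ P y) -> exists y, y ∈ x /\ P y /\ forall z, z ∈ x -> P z -> z ∉ y.
Proof.
  intros HP (y & Hy & Py). destruct (separation x HP) as [X HX].
  destruct (zf_foundation hZF (x := X)) as (z & Hz & H); [exists y; now apply HX|].
  apply HX in Hz as [Hz Pz]. exists z. repeat split; auto.
  intros w Hw Pw. apply H. now apply HX.
Qed.

Lemma mem_irrefl (x : M) : x ∉ x.
Proof.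
  intros H. destruct (foundation (P := fun y => y = x) (x := x)) as (y & Hy & E & K);
    [definable_tac | exists x; split; auto | subst y; exact (K x H eq_refl H)].
Qed.

Lemma ordinal_mem (a b : M) : is_ordinal a -> b ∈ a -> is_ordinal b.
Proof.
  intros [T H] Hb. split; [now apply H|]. intros c Hc. apply H. now apply (T b).
Qed.

Lemma ordinal_trans (a b c : M) : is_ordinal c -> a ∈ b -> b ∈ c -> a ∈ c.
Proof. intros [T _] Ha Hb. now apply (T b). Qed.

Lemma ordinal_succ (a s : M) : is_ordinal a -> is_succ s a -> is_ordinal s.
Proof.
  intros Ha Hs. split.
  - intros y Hy z Hz. apply Hs. left. apply Hs in Hy as [Hy| ->]; auto.
    exact (ordinal_trans Ha Hz Hy).
  - intros y Hy. apply Hs in Hy as [Hy| ->]; [exact (proj2 Ha y Hy) | exact (proj1 Ha)].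
Qed.

Lemma ordinal_least (P : M -> Prop) (a : M) : definable 1 (fun e => P (e 0)) ->
  is_ordinal a -> P a ->
  exists b, is_ordinal b /\ P b /\ (forall c, c ∈ b -> ~ P c) /\ (b = a \/ b ∈ a).
Proof.
  intros HP Ha Pa. destruct (succ_exists a) as [s Hs].
  destruct (foundation (x := s) HP) as (b & Hb & Pb & K).
  { exists a. split; auto. apply Hs; auto. }
  pose proof (ordinal_succ Ha Hs) as Os.
  exists b. split; [exact (ordinal_mem Os Hb)|]. split; auto. split.
  - intros c Hc Pc. apply (K c); auto. exact (ordinal_trans Os Hc Hb).
  - apply Hs in Hb. tauto.
Qed.

Lemma ordinal_induction (P : M -> Prop) : definable 1 (fun e => P (e 0)) ->
  (forall a, is_ordinal a -> (forall b, b ∈ a -> P b) -> P a) ->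
  forall a, is_ordinal a -> P a.
Proof.
  intros HP H a Ha. apply NNPP. intros N.
  destruct (ordinal_least (P := fun x => ~ P x)) with (a := a) as (b & Hb & Nb & K & _);
    [definable_tac | exact Ha | exact N |].
  apply Nb, H; auto. intros c Hc. apply NNPP. now apply K.
Qed.

Lemma ordinal_total (a b : M) : is_ordinal a -> is_ordinal b ->
  a ∈ b \/ a = b \/ b ∈ a.
Proof.
  intros Ha Hb. revert a Ha b Hb.
  apply (ordinal_induction
    (P := fun a => forall b, is_ordinal b -> a ∈ b \/ a = b \/ b ∈ a)); [definable_tac|].
  intros a Ha IHa.
  apply (ordinal_induction (P := fun b => a ∈ b \/ a = b \/ b ∈ a)); [definable_tac|].
  intros b Hb IHb.
  destruct (classic (a ∈ b)); auto. destruct (classic (b ∈ a)); auto.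
  right; left. apply set_ext. intros z. split; intros Hz.
  - destruct (IHa z Hz b Hb) as [K|[->|K]]; auto; [now exfalso|].
    destruct H0. exact (ordinal_trans Ha K Hz).
  - destruct (IHb z Hz) as [K|[->|K]]; auto; [|now exfalso].
    destruct H. exact (ordinal_trans Hb K Hz).
Qed.

Lemma ordinal_not_mem (a b : M) : is_ordinal a -> is_ordinal b -> a ∉ b -> b ⊆ a.
Proof.
  intros Ha Hb H. destruct (ordinal_total Ha Hb) as [K|[->|K]].
  - now exfalso.
  - intros z; auto.
  - exact (proj1 Ha b K).
Qed.

Lemma ordinal_subset (a b : M) : is_ordinal a -> is_ordinal b -> a ⊆ b -> a = b \/ a ∈ b.
Proof.
  intros Ha Hb H. destruct (ordinal_total Ha Hb) as [K|[K|K]]; auto.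
  destruct (mem_irrefl (H b K)).
Qed.

Lemma ordinal_subset_mem (a b c : M) : is_ordinal a -> is_ordinal b -> is_ordinal c ->
  a ⊆ b -> b ∈ c -> a ∈ c.
Proof.
  intros Ha Hb Hc H K. destruct (ordinal_subset Ha Hb H) as [->|L]; auto.
  exact (ordinal_trans Hc L K).
Qed.

Lemma ordinal_bound (X : M) :
  exists b, is_ordinal b /\ forall a, a ∈ X -> is_ordinal a -> a ∈ b.
Proof.
  destruct (separation (P := @is_ordinal M) X) as [X' HX']; [definable_tac|].
  destruct (zf_union hZF X') as [u Hu]. destruct (succ_exists u) as [s Hs].
  assert (is_ordinal u) as Ou.
  { split.
    - intros y Hy z Hz. apply Hu in Hy as (a & Ha & Hy). apply Hu. exists a.
      split; auto. apply HX' in Ha as [_ Ha]. exact (ordinal_trans Ha Hz Hy).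
    - intros y Hy. apply Hu in Hy as (a & Ha & Hy). apply HX' in Ha as [_ Ha].
      exact (proj2 Ha y Hy). }
  exists s. split; [exact (ordinal_succ Ou Hs)|]. intros a Ha Oa.
  apply (ordinal_subset_mem Oa Ou (ordinal_succ Ou Hs)); [|apply Hs; auto].
  intros z Hz. apply Hu. exists a. split; auto. now apply HX'.
Qed.

End Sets.

(** * Order types of sets of ordinals *)

(** The order type of X below x is at most a, again as a greatest fixed point
    witnessed by a set. *)
Definition height_le (M : set_structure) (X x a : M) : Prop :=
  exists r : M, related r x a /\
    forall y b : M, related r y b -> forall z, z ∈ X -> z ∈ y ->
      exists c, c ∈ b /\ related r z c.

Section Collapse.
Context {M : set_structure} (hZF : ZF M).

Lemma equinumerous_intro (X Z : M) (R : M -> M -> Prop) :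
  definable 2 (fun e => R (e 0) (e 1)) ->
  (forall a, a ∈ X -> exists b, b ∈ Z /\ R a b) ->
  (forall b, b ∈ Z -> exists a, a ∈ X /\ R a b) ->
  (forall a a' b b', a ∈ X -> a' ∈ X -> b ∈ Z -> b' ∈ Z -> R a b -> R a' b' ->
    (a = a' <-> b = b')) ->
  equinumerous X Z.
Proof.
  intros HR Htot Hsur Hinj.
  destruct (relation_exists hZF X Z HR) as (f & Hf & Hp).
  exists f. split; [split; [split|]|].
  - exact Hp.
  - intros a Ha. destruct (Htot a Ha) as (b & Hb & Hab).
    exists b. split; [now apply Hf|]. intros c Hc. apply Hf in Hc as (_ & Hc & Hac).
    now apply (Hinj a a b c Ha Ha Hb Hc Hab Hac).
  - intros a b H. now apply Hf in H.
  - intros b Hb. destruct (Hsur b Hb) as (a & Ha & Hab).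
    exists a. split; [now apply Hf|]. intros c Hc. apply Hf in Hc as (Hc & _ & Hac).
    now apply (Hinj a c b b Ha Hc Hb Hb Hab Hac).
Qed.

Lemma height_le_definable (X : M) :
  definable 2 (fun e => height_le X (e 0) (e 1)).
Proof. unfold height_le. definable_tac. Qed.

(** For the converse, the pairs that satisfy the relation form a witness once
    they are restricted to a set. *)
Lemma height_le_iff (X x a : M) : is_ordinal a ->
  (height_le X x a <->
    forall z, z ∈ X -> z ∈ x -> exists c, c ∈ a /\ height_le X z c).
Proof.
  intros Ha. split.
  - intros (r & Hr & H) z Hz Hzx. destruct (H x a Hr z Hz Hzx) as (c & Hc & Hrc).
    exists c. split; auto. now exists r.
  - intros H. destruct (singleton_exists hZF x) as [X0 HX0].
    destruct (union2_exists hZF X X0) as [X1 HX1].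
    destruct (succ_exists hZF a) as [s Hs].
    pose proof (height_le_definable X) as HD.
    destruct (relation_exists hZF X1 s
      (Q := fun y b => height_le X y b \/ (y = x /\ b = a))) as (r & Hr & _);
      [definable_tac|].
    exists r. split.
    + apply Hr. rewrite HX1, HX0, (Hs a). auto.
    + intros y b Hyb z Hz Hzy. apply Hr in Hyb as (Hy & Hb & Hyb).
      assert (exists c, c ∈ b /\ height_le X z c) as (c & Hc & Hzc).
      { destruct Hyb as [(q & Hq & K)|[-> ->]]; [|now apply H].
        destruct (K y b Hq z Hz Hzy) as (c & Hc & Hqc). exists c. split; auto. now exists q. }
      exists c. split; auto. apply Hr. rewrite HX1. repeat split; auto.
      exact (ordinal_trans (ordinal_succ Ha Hs) Hc Hb).
Qed.

Lemma height_le_self (X x : M) : is_ordinal x -> height_le X x x.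
Proof.
  pose proof (height_le_definable X) as HD. revert x.
  apply (ordinal_induction hZF (P := fun x => height_le X x x)); [definable_tac|].
  intros x Hx IH. apply (height_le_iff X x Hx). intros z _ Hz. eauto.
Qed.

(** The Mostowski collapse of X: x goes to the least b with [height_le X x b].
    The values form an ordinal because a value d skipped below the value of
    some x would be attained at the first y of X whose height is not below d. *)
Lemma subset_ordinal_equinumerous (X a : M) : is_ordinal a -> X ⊆ a ->
  exists b, is_ordinal b /\ b ⊆ a /\ equinumerous b X.
Proof.
  intros Ha HX. pose proof (height_le_definable X) as HD.
  set (height := fun x b => height_le X x b /\ forall c, c ∈ b -> ~ height_le X x c).
  assert (Hdef : definable 2 (fun e => height (e 0) (e 1))) by (unfold height; definable_tac).
  assert (Hle : forall x b c, is_ordinal b -> is_ordinal c -> height x b ->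
    height_le X x c -> b ⊆ c).
  { intros x b c Hb Hc [_ H] K. apply (ordinal_not_mem hZF Hc Hb). intros L. now apply (H c). }
  assert (Hex : forall x, x ∈ X -> exists b, b ∈ a /\ is_ordinal b /\ height x b).
  { intros x Hx. pose proof (ordinal_mem Ha (HX x Hx)) as Ox.
    destruct (ordinal_least hZF (P := height_le X x)) with (a := x)
      as (b & Hb & H & K & L); [definable_tac | exact Ox | now apply height_le_self |].
    exists b. split; [|split; [exact Hb | now split]].
    destruct L as [->|L]; [now apply HX | exact (ordinal_trans Ha L (HX x Hx))]. }
  assert (Hmono : forall x y b c, x ∈ X -> y ∈ X -> is_ordinal b -> is_ordinal c ->
    height x b -> height y c -> x ∈ y -> b ∈ c).
  { intros x y b c Hx Hy Hb Hc Hxb Hyc Hxy.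
    destruct (proj1 (height_le_iff X y Hc) (proj1 Hyc) x Hx Hxy) as (d & Hd & Hxd).
    pose proof (ordinal_mem Hc Hd) as Od.
    exact (ordinal_subset_mem hZF Hb Od Hc (Hle x b d Hb Od Hxb Hxd) Hd). }
  destruct (separation hZF (P := fun b => exists x, x ∈ X /\ height x b) a) as [b Hb];
    [definable_tac|].
  assert (Htrans : forall c d, c ∈ b -> d ∈ c -> d ∈ b).
  { intros c d Hc Hd. apply Hb in Hc as (Hca & x & Hx & Hxc).
    pose proof (ordinal_mem Ha Hca) as Oc. pose proof (ordinal_mem Oc Hd) as Od.
    apply Hb. split; [exact (ordinal_trans Ha Hd Hca)|].
    assert (exists y, y ∈ X /\ ~ exists d', d' ∈ d /\ height_le X y d') as (y0 & Hy0 & Ny0).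
    { apply NNPP. intros N. apply (proj2 Hxc d Hd). apply (height_le_iff X x Od).
      intros z Hz _. apply NNPP. intros N'. apply N. now exists z. }
    destruct (ordinal_least hZF
      (P := fun y => y ∈ X /\ ~ exists d', d' ∈ d /\ height_le X y d')) with (a := y0)
      as (y & Oy & [Hy Ny] & Hmin & _);
      [definable_tac | exact (ordinal_mem Ha (HX y0 Hy0)) | now split |].
    exists y. split; auto. split.
    - apply (height_le_iff X y Od). intros z Hz Hzy. apply NNPP. intros N.
      now apply (Hmin z Hzy).
    - intros d' Hd' K. apply Ny. now exists d'. }
  assert (Ob : is_ordinal b).
  { split.
    - intros c Hc d Hd. eauto.
    - intros c Hc. apply Hb in Hc as [Hc _]. exact (proj1 (ordinal_mem Ha Hc)). }
  exists b. split; [exact Ob|]. split; [intros c Hc; now apply Hb in Hc|].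
  apply (equinumerous_intro (R := fun c x => height x c)); [definable_tac | | |].
  - intros c Hc. apply Hb in Hc as (_ & x & Hx & Hxc). eauto.
  - intros x Hx. destruct (Hex x Hx) as (c & Hc & Oc & Hxc). exists c.
    split; auto. apply Hb. eauto.
  - intros c d x y Hc Hd Hx Hy Hxc Hyd.
    pose proof (ordinal_mem Ob Hc) as Oc. pose proof (ordinal_mem Ob Hd) as Od.
    split.
    + intros <-. destruct (ordinal_total hZF (ordinal_mem Ha (HX x Hx))
        (ordinal_mem Ha (HX y Hy))) as [K|[K|K]]; auto; exfalso.
      * exact (mem_irrefl hZF (Hmono x y c c Hx Hy Oc Oc Hxc Hyd K)).
      * exact (mem_irrefl hZF (Hmono y x c c Hy Hx Oc Oc Hyd Hxc K)).
    + intros <-. apply (set_ext hZF). intros z. split; intros Hz.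
      * exact (Hle x c d Oc Od Hxc (proj1 Hyd) z Hz).
      * exact (Hle x d c Od Oc Hyd (proj1 Hxc) z Hz).
Qed.

End Collapse.

(** * Large sets *)

(** Completeness for indexed families, which may repeat, unlike the sets of
    members of D that [is_complete] speaks of. *)
Definition family_complete (M : set_structure) (D Y I : M) : Prop :=
  forall Q : M -> M -> Prop, definable 2 (fun e => Q (e 0) (e 1)) ->
    (forall i, i ∈ I -> large D Y (Q i)) ->
    large D Y (fun s => forall i, i ∈ I -> Q i s).

Section Filters.
Context {M : set_structure} (hZF : ZF M).

Lemma large_mono (D Y : M) (P Q : M -> Prop) : is_filter D Y ->
  definable 1 (fun e => Q (e 0)) -> large D Y P ->
  (forall s, s ∈ Y -> P s -> Q s) -> large D Y Q.
Proof.
  intros (_ & _ & _ & Hup & _) HQ (A & HA & HAP) H.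
  destruct (separation hZF Y HQ) as [B HB]. exists B. split; [|exact HB].
  apply (Hup A B HA).
  - intros s Hs. apply HAP in Hs as [Hs HPs]. apply HB. auto.
  - intros s Hs. now apply HB in Hs.
Qed.

Lemma large_and (D Y : M) (P Q : M -> Prop) : is_filter D Y ->
  large D Y P -> large D Y Q -> large D Y (fun s => P s /\ Q s).
Proof.
  intros (_ & _ & _ & _ & Hand) (A & HA & HAP) (B & HB & HBQ).
  destruct (separation hZF (P := fun s => s ∈ B) A) as [C HC]; [definable_tac|].
  exists C. split; [exact (Hand A B C HA HB HC)|].
  intros s. rewrite HC, HAP, HBQ. tauto.
Qed.

Lemma large_mono2 (D Y : M) (P1 P2 Q : M -> Prop) : is_filter D Y ->
  definable 1 (fun e => Q (e 0)) -> large D Y P1 -> large D Y P2 ->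
  (forall s, s ∈ Y -> P1 s -> P2 s -> Q s) -> large D Y Q.
Proof.
  intros F HQ H1 H2 H. apply (large_mono F HQ (large_and F H1 H2)).
  intros s Hs [K1 K2]. auto.
Qed.

Lemma large_always (D Y : M) (P : M -> Prop) : is_filter D Y ->
  (forall s, s ∈ Y -> P s) -> large D Y P.
Proof.
  intros (_ & HY & _) H. exists Y. split; auto. intros s. split; [auto|tauto].
Qed.

Lemma large_inhabited (D Y : M) (P : M -> Prop) : is_filter D Y ->
  large D Y P -> exists s, s ∈ Y /\ P s.
Proof.
  intros (_ & _ & H0 & _) (A & HA & HAP). apply NNPP. intros N.
  apply (H0 A); auto. intros s Hs. apply HAP in Hs. apply N. now exists s.
Qed.

Lemma large_or_not (D Y : M) (P : M -> Prop) : is_ultrafilter D Y ->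
  definable 1 (fun e => P (e 0)) -> large D Y P \/ large D Y (fun s => ~ P s).
Proof.
  intros [_ HU] HP.
  destruct (separation hZF Y HP) as [A HA].
  destruct (separation hZF (P := fun s => s ∉ A) Y) as [B HB]; [definable_tac|].
  destruct (HU A B) as [K|K]; auto.
  - intros s Hs. now apply HA in Hs.
  - left. now exists A.
  - right. exists B. split; auto. intros s. rewrite HB, HA. tauto.
Qed.

(** The distinct sets of the family correspond to the indices of their first
    occurrences; these form a subset of I, which has the size of an ordinal at
    most I. *)
Lemma complete_family_complete (k D Y I : M) : is_ordinal k -> I ∈ k ->
  is_complete k D Y -> family_complete D Y I.
Proof.
  intros Hk HI Hc Q HQ HL. pose proof (ordinal_mem Hk HI) as OI.
  set (same := fun i j => forall s, s ∈ Y -> (Q i s <-> Q j s)).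
  assert (Hsame : definable 2 (fun e => same (e 0) (e 1))) by (unfold same; definable_tac).
  set (ext := fun i A => forall s, s ∈ A <-> s ∈ Y /\ Q i s).
  assert (Hext : definable 2 (fun e => ext (e 0) (e 1))) by (unfold ext; definable_tac).
  assert (Hss : forall i j A, ext i A -> ext j A -> same i j).
  { intros i j A Ei Ej s Hs. split; intros K.
    - apply (Ej s), Ei. auto.
    - apply (Ei s), Ej. auto. }
  destruct (separation hZF (P := fun i => forall j, j ∈ i -> ~ same i j) I) as [X HX];
    [definable_tac|].
  destruct (separation hZF (P := fun A => exists i, i ∈ I /\ ext i A) D) as [S HS];
    [definable_tac|].
  assert (Hfirst : forall i, i ∈ I -> exists j, j ∈ X /\ same i j).
  { intros i Hi.
    destruct (ordinal_least hZF (P := fun j => same i j)) with (a := i)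
      as (j & Oj & Hj & Hmin & Hji); [definable_tac | exact (ordinal_mem OI Hi) | |].
    { intros s _. tauto. }
    exists j. split; [|exact Hj]. apply HX. split.
    - destruct Hji as [->|Hji]; [exact Hi | exact (ordinal_trans OI Hji Hi)].
    - intros l Hl K. apply (Hmin l Hl). intros s Hs. now rewrite (Hj s Hs), (K s Hs). }
  destruct (subset_ordinal_equinumerous hZF (X := X) OI) as (b & Ob & HbI & f & Hf);
    [intros i Hi; now apply HX in Hi|].
  assert (Hbk : b ∈ k) by exact (ordinal_subset_mem hZF Ob OI Hk HbI HI).
  assert (HbS : equinumerous b S).
  { destruct Hf as [[Hf HfX] Hinj].
    apply (equinumerous_intro hZF (R := fun c A => exists i, related f c i /\ ext i A));
      [definable_tac | | |].
    - intros c Hc0. destruct (function_total Hf Hc0) as [i Hi].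
      pose proof (proj1 (proj1 (HX i) (HfX c i Hi))) as HiI.
      destruct (HL i HiI) as (A & HA & HAQ). exists A. split; [|now exists i].
      apply HS. split; auto. now exists i.
    - intros A HA. apply HS in HA as (_ & i & Hi & HiA).
      destruct (Hfirst i Hi) as (j & Hj & Hij).
      destruct (Hinj j Hj) as (c & Hcj & _). exists c.
      split; [exact (function_domain Hf Hcj)|]. exists j. split; auto.
      intros s. rewrite (HiA s). split; intros [Hs K]; (split; [exact Hs|]); now apply (Hij s Hs).
    - intros c c' A A' Hc0 Hc' HA HA' (i & Hci & HiA) (i' & Hci' & HiA'). split.
      + intros <-. rewrite <- (function_unique Hf Hci Hci') in HiA'.
        apply (set_ext hZF). intros s. now rewrite (HiA s), (HiA' s).
      + intros <-. pose proof (Hss i i' A HiA HiA') as Hs.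
        pose proof (proj1 (HX i) (HfX c i Hci)) as [Hi Mi].
        pose proof (proj1 (HX i') (HfX c' i' Hci')) as [Hi' Mi'].
        assert (i = i') as <-.
        { destruct (ordinal_total hZF (ordinal_mem OI Hi) (ordinal_mem OI Hi'))
            as [K|[K|K]]; auto; exfalso.
          - apply (Mi' i K). intros s Ys. now rewrite (Hs s Ys).
          - now apply (Mi i' K). }
        destruct (Hinj i (HfX c i Hci)) as (d & _ & U).
        now rewrite <- (U c Hci), <- (U c' Hci'). }
  destruct (separation hZF (P := fun s => forall A, A ∈ S -> s ∈ A) Y) as [C HC];
    [definable_tac|].
  exists C. split.
  - apply (Hc S b C); auto. intros A HA. now apply HS in HA.
  - intros s. rewrite HC. split; intros [Hs K]; split; auto.
    + intros i Hi. destruct (HL i Hi) as (A & HA & HAQ). apply HAQ.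
      apply K. apply HS. split; auto. now exists i.
    + intros A HA. apply HS in HA as (_ & i & Hi & HiA). apply HiA. auto.
Qed.

End Filters.

(** * The rank *)

Section Rank.
Context {M : set_structure} (hZF : ZF M).

Lemma eq_mod_refl (D Y f : M) : is_filter D Y -> is_function_on f Y -> eq_mod D Y f f.
Proof.
  intros F Hf. apply large_always; auto. intros s Hs.
  destruct (function_total Hf Hs) as [a Ha]. eauto.
Qed.

Lemma eq_mod_sym (D Y f g : M) : is_filter D Y -> eq_mod D Y f g -> eq_mod D Y g f.
Proof.
  intros F H. apply (large_mono hZF F) with (2 := H); [definable_tac|].
  intros s _ (a & Hf & Hg). eauto.
Qed.

Lemma eq_mod_trans (D Y f g h : M) : is_filter D Y -> is_function_on g Y ->
  eq_mod D Y f g -> eq_mod D Y g h -> eq_mod D Y f h.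
Proof.
  intros F Hg H K. apply (large_mono2 hZF F) with (2 := H) (3 := K); [definable_tac|].
  intros s _ (a & Hfa & Hga) (b & Hgb & Hhb).
  rewrite (function_unique Hg Hgb Hga) in Hhb. eauto.
Qed.

Lemma lt_eq_mod (D Y f g h : M) : is_filter D Y -> is_function_on g Y ->
  lt_mod D Y f g -> eq_mod D Y g h -> lt_mod D Y f h.
Proof.
  intros F Hg H K. apply (large_mono2 hZF F) with (2 := H) (3 := K); [definable_tac|].
  intros s _ (a & b & Hfa & Hgb & Hab) (c & Hgc & Hhc).
  rewrite (function_unique Hg Hgc Hgb) in Hhc. eauto.
Qed.

Lemma maps_to_ordinal_function (f Y b : M) : is_ordinal b -> maps_to f Y b ->
  is_ordinal_function f Y.
Proof.
  intros Hb [Hf H]. split; auto. intros s a Hs. exact (ordinal_mem Hb (H s a Hs)).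
Qed.

Lemma ordinal_function_bound (f Y : M) : is_ordinal_function f Y ->
  exists b, is_ordinal b /\ maps_to f Y b.
Proof.
  intros [Hf Ho]. destruct (range_exists hZF f) as [u Hu].
  destruct (ordinal_bound hZF u) as (b & Hb & H). exists b. split; auto. split; auto.
  intros s a Hs. apply H; [exact (proj2 (Hu s a Hs)) | exact (Ho s a Hs)].
Qed.

(** Let h' agree with h where h is below g, and with g elsewhere. *)
Lemma lt_mod_truncate (D Y g h b : M) : is_filter D Y -> is_ordinal b ->
  maps_to g Y b -> is_function_on h Y -> lt_mod D Y h g ->
  exists h', maps_to h' Y b /\ eq_mod D Y h' h.
Proof.
  intros F Hb [Hg Hgb] Hh H.
  set (below := fun s x => exists v, related h s x /\ related g s v /\ x ∈ v).
  assert (Hbelow : definable 2 (fun e => below (e 0) (e 1)))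
    by (unfold below; definable_tac).
  destruct (function_exists hZF (X := Y)
    (Q := fun s x => below s x \/ ((forall y, ~ below s y) /\ related g s x)))
    as (h' & Hh' & E); [definable_tac | |].
  { intros s Hs. destruct (classic (exists x, below s x)) as [[x Hx]|N].
    - exists x. split; auto. intros y [(v & Hy & _)|[K _]].
      + destruct Hx as (v' & Hx & _). exact (function_unique Hh Hx Hy).
      + destruct (K x Hx).
    - destruct (function_total Hg Hs) as [x Hx]. exists x. split.
      + right. split; auto. intros y Hy. apply N. eauto.
      + intros y [Hy|[_ Hy]]; [destruct N; eauto | exact (function_unique Hg Hx Hy)]. }
  exists h'. split; [split; auto|].
  - intros s x Hx. apply E in Hx as [_ [(v & _ & Hv & Hxv)|[_ Hx]]].
    + exact (ordinal_trans Hb Hxv (Hgb s v Hv)).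
    + exact (Hgb s x Hx).
  - apply (large_mono hZF F) with (2 := H); [definable_tac|].
    intros s Hs (a & v & Ha & Hv & Hav). exists a. split; auto. apply E. split; auto.
    left. now exists v.
Qed.

(** The recursion clause.  From right to left, the witness consists of the
    functions into a fixed bound of f that are equal modulo D to one of rank
    at most c, together with f itself; truncation keeps it a witness. *)
Lemma rank_le_iff (D Y f a : M) : is_filter D Y -> is_ordinal_function f Y -> is_ordinal a ->
  (rank_le D Y f a <->
    forall h, is_ordinal_function h Y -> lt_mod D Y h f -> exists c, c ∈ a /\ rank_le D Y h c).
Proof.
  intros F Hf Ha.
  assert (step : forall g b h, rank_le D Y g b -> is_ordinal_function h Y ->
    lt_mod D Y h g -> exists h' c, is_ordinal_function h' Y /\ eq_mod D Y h' h /\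
      c ∈ b /\ rank_le D Y h' c).
  { intros g b h (r & Hr & H) Hh Hlt.
    destruct (H g b Hr h Hh Hlt) as (h' & c & Hh' & He & Hc & Hrc).
    exists h', c. do 3 (split; [assumption|]). now exists r. }
  assert (back : forall f, is_ordinal_function f Y -> forall a, is_ordinal a ->
    (forall h, is_ordinal_function h Y -> lt_mod D Y h f ->
      exists h' c, is_ordinal_function h' Y /\ eq_mod D Y h' h /\ c ∈ a /\ rank_le D Y h' c) ->
    rank_le D Y f a).
  { clear f Hf a Ha. intros f Hf a Ha H.
    destruct (ordinal_function_bound Hf) as (b & Hb & Hfb).
    destruct (functions_exist hZF Y b) as [B HB].
    destruct (succ_exists hZF a) as [s Hs].
    destruct (relation_exists hZF B s (Q := fun g c =>
      (exists g', is_ordinal_function g' Y /\ eq_mod D Y g' g /\ rank_le D Y g' c) \/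
      (g = f /\ c = a))) as (r & Hr & _); [definable_tac|].
    exists r. split.
    { apply Hr. rewrite HB, (Hs a). auto. }
    intros g c Hgc h Hh Hlt. apply Hr in Hgc as (Hg & Hc & Hgc). apply HB in Hg.
    assert (exists h' d, is_ordinal_function h' Y /\ eq_mod D Y h' h /\ d ∈ c /\
      rank_le D Y h' d) as (h' & d & Hh' & He & Hd & Hr').
    { destruct Hgc as [(g' & Hg' & Hgg' & Hr')|[-> ->]]; [|now apply H].
      apply (step g' c h Hr' Hh).
      exact (lt_eq_mod F (proj1 Hg) Hlt (eq_mod_sym F Hgg')). }
    destruct (lt_mod_truncate F Hb Hg (proj1 Hh) Hlt) as (k & Hk & Hke).
    exists k, d. split; [exact (maps_to_ordinal_function Hb Hk)|].
    split; [exact Hke|]. split; [exact Hd|]. apply Hr. rewrite HB.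
    split; [exact Hk|]. split; [exact (ordinal_trans (ordinal_succ Ha Hs) Hd Hc)|].
    left. exists h'. split; [exact Hh'|]. split; [|exact Hr'].
    exact (eq_mod_trans F (proj1 Hh) He (eq_mod_sym F Hke)). }
  split.
  - intros H h Hh Hlt. destruct (step f a h H Hh Hlt) as (h' & c & Hh' & He & Hc & Hr).
    exists c. split; [exact Hc|].
    apply back; [exact Hh | exact (ordinal_mem Ha Hc) |].
    intros k Hk Hkh. apply (step h' c k Hr Hk).
    exact (lt_eq_mod F (proj1 Hh) Hkh (eq_mod_sym F He)).
  - intros H. apply back; auto. intros h Hh Hlt.
    destruct (H h Hh Hlt) as (c & Hc & Hr). exists h, c.
    split; [exact Hh|]. split; [exact (eq_mod_refl F (proj1 Hh)) | now split].
Qed.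

Lemma lt_mod_trans (D Y f g h : M) : is_filter D Y -> is_function_on g Y ->
  is_ordinal_function h Y -> lt_mod D Y f g -> lt_mod D Y g h -> lt_mod D Y f h.
Proof.
  intros F Hg Hh H K. apply (large_mono2 hZF F) with (2 := H) (3 := K); [definable_tac|].
  intros s _ (a & b & Hfa & Hgb & Hab) (b' & c & Hgb' & Hhc & Hbc).
  rewrite (function_unique Hg Hgb' Hgb) in Hbc. exists a, c.
  split; [exact Hfa|]. split; [exact Hhc|].
  exact (ordinal_trans (proj2 Hh s c Hhc) Hab Hbc).
Qed.

Lemma eq_lt_mod (D Y f g h : M) : is_filter D Y -> is_function_on g Y ->
  eq_mod D Y f g -> lt_mod D Y g h -> lt_mod D Y f h.
Proof.
  intros F Hg H K. apply (large_mono2 hZF F) with (2 := H) (3 := K); [definable_tac|].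
  intros s _ (c & Hfc & Hgc) (a & b & Hga & Hhb & Hab).
  rewrite (function_unique Hg Hga Hgc) in Hab. eauto.
Qed.

Lemma rank_le_eq_mod (D Y f g a : M) : is_filter D Y -> is_ordinal_function f Y ->
  is_ordinal_function g Y -> is_ordinal a -> eq_mod D Y f g ->
  rank_le D Y f a -> rank_le D Y g a.
Proof.
  intros F Hf Hg Ha He H. apply (rank_le_iff F Hg Ha). intros h Hh Hlt.
  apply (proj1 (rank_le_iff F Hf Ha) H h Hh).
  exact (lt_eq_mod F (proj1 Hg) Hlt (eq_mod_sym F He)).
Qed.

Lemma constant_exists (Y z : M) : exists c, is_constant c Y z.
Proof.
  destruct (function_exists hZF (X := Y) (Q := fun _ x => x = z)) as (c & Hc & E).
  - definable_tac.
  - intros s _. exists z. split; auto.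
  - exists c. split; auto. intros s Hs. now apply E.
Qed.

Lemma constant_ordinal_function (c Y z : M) : is_ordinal z -> is_constant c Y z ->
  is_ordinal_function c Y.
Proof.
  intros Hz [Hc H]. split; auto. intros s a Hs.
  rewrite (function_unique Hc Hs (H s (function_domain Hc Hs))). exact Hz.
Qed.

(** If rk_D(z) <= b < z, then the constant b, being below z, has rank less
    than b. *)
Lemma constant_rank_ge (D Y : M) : is_filter D Y -> forall b, is_ordinal b ->
  forall z c, is_ordinal z -> is_constant c Y z -> b ∈ z -> ~ rank_le D Y c b.
Proof.
  intros F.
  apply (ordinal_induction hZF (P := fun b => forall z c, is_ordinal z ->
    is_constant c Y z -> b ∈ z -> ~ rank_le D Y c b)); [definable_tac|].
  intros b Hb IH z c Hz Hc Hbz H.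
  destruct (constant_exists Y b) as [d Hd].
  pose proof (constant_ordinal_function Hz Hc) as Oc.
  pose proof (constant_ordinal_function Hb Hd) as Od.
  destruct (proj1 (rank_le_iff F Oc Hb) H d Od) as (b' & Hb' & Hr).
  - apply large_always; auto. intros s Hs. exists b, z.
    split; [now apply Hd|]. split; [now apply Hc | exact Hbz].
  - exact (IH b' Hb' b d Hb Hd Hb' Hr).
Qed.

(** The rank relation is: a is the least ordinal with [rank_le D Y f a].  The
    recursion clause passes to it since every bound lies above a least one. *)
Lemma rank_const_intro (D Y z c : M) : is_filter D Y -> is_ordinal z ->
  is_constant c Y z -> rank_le D Y c z -> rank_const_is D Y z z.
Proof.
  intros F Hz Hc H. exists c. split; [exact Hc|].
  split; [exact (constant_ordinal_function Hz Hc)|]. split; [exact Hz|].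
  set (R := fun f a => rank_le D Y f a /\ forall b, b ∈ a -> ~ rank_le D Y f b).
  exists R. split; [split|].
  - assert (definable 2 (fun e => R (e 0) (e 1))) as (p & e & E)
      by (unfold R; definable_tac).
    exists p, e. intros f a. apply (E (scons f (fun _ => a))).
  - assert (least : forall f a, is_ordinal a -> rank_le D Y f a ->
      exists b, (b = a \/ b ∈ a) /\ R f b).
    { intros f a Ha K.
      destruct (ordinal_least hZF (P := fun b => rank_le D Y f b)) with (a := a)
        as (b & Hb & Hr & Hmin & L); [definable_tac | exact Ha | exact K |].
      exists b. split; [exact L | split; auto]. }
    intros f a Hf Ha. split.
    + intros [K N]. split; [intros b Hb [L _]; exact (N b Hb L)|].
      intros g Hg Hlt. destruct (proj1 (rank_le_iff F Hf Ha) K g Hg Hlt) as (b & Hb & L).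
      destruct (least g b (ordinal_mem Ha Hb) L) as (d & Hd & Rd). exists d.
      split; [|exact Rd]. destruct Hd as [->|Hd]; [exact Hb | exact (ordinal_trans Ha Hd Hb)].
    + intros [N K]. split.
      * apply (rank_le_iff F Hf Ha). intros g Hg Hlt.
        destruct (K g Hg Hlt) as (b & Hb & [L _]). eauto.
      * intros b Hb L. destruct (least f b (ordinal_mem Ha Hb) L) as (d & Hd & Rd).
        apply (N d); [|exact Rd].
        destruct Hd as [->|Hd]; [exact Hb | exact (ordinal_trans Ha Hd Hb)].
  - split; [exact H|]. intros b Hb. exact (constant_rank_ge F (ordinal_mem Hz Hb) Hz Hc Hb).
Qed.

(** Dependent choice gives a descending sequence of functions; by completeness it
    descends at a single point of Y, against foundation. *)
Lemma lt_mod_minimal (D Y w X : M) : DC M -> is_filter D Y -> is_omega w ->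
  family_complete D Y w -> (exists g, g ∈ X) ->
  (forall g, g ∈ X -> is_function_on g Y) ->
  exists g, g ∈ X /\ forall h, h ∈ X -> ~ lt_mod D Y h g.
Proof.
  intros hDC F Hw HD HX Hfun. apply NNPP. intros N.
  destruct (relation_exists hZF X X (Q := fun g h => lt_mod D Y h g)) as (r & Hr & _);
    [definable_tac|].
  destruct (hDC X r HX) as (w' & f & Hw' & [Hf HfX] & Hstep).
  { intros g Hg. apply NNPP. intros N'. apply N. exists g. split; auto.
    intros h Hh Hlt. apply N'. exists h. split; auto. apply Hr. auto. }
  assert (w' = w) as ->.
  { apply (set_ext hZF). intros z. split; intros Hz.
    - exact (proj2 Hw' w (proj1 Hw) z Hz).
    - exact (proj2 Hw w' (proj1 Hw') z Hz). }
  set (descends := fun n t => exists m x y a b, m ∈ w /\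
    related f n x /\ related f m y /\ related y t a /\ related x t b /\ a ∈ b).
  assert (Hdesc : definable 2 (fun e => descends (e 0) (e 1)))
    by (unfold descends; definable_tac).
  assert (HL : forall n, n ∈ w -> large D Y (descends n)).
  { intros n Hn. destruct (proj2 (proj1 Hw) n Hn) as (m & Hm & Hmw).
    destruct (function_total Hf Hn) as [x Hx]. destruct (function_total Hf Hmw) as [y Hy].
    pose proof (Hstep n m x y Hn Hm Hx Hy) as Hxy. apply Hr in Hxy as (_ & _ & Hlt).
    apply (large_mono hZF F) with (2 := Hlt); [definable_tac|].
    intros s _ (a & b & Ha & Hb & Hab). exists m, x, y, a, b. auto 6. }
  destruct (large_inhabited F (HD descends Hdesc HL)) as (t & Ht & H).
  destruct (zf_union hZF X) as [q Hq]. destruct (range_exists hZF q) as [u Hu].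
  assert (Hin : forall n x b, related f n x -> related x t b -> b ∈ u).
  { intros n x b Hx (p & Hp & Hpx). apply (Hu t b). exists p. split; auto.
    apply Hq. exists x. split; [exact (HfX n x Hx) | exact Hpx]. }
  destruct (foundation hZF (x := u)
    (P := fun b => exists n x, related f n x /\ related x t b))
    as (b & Hb & (n & x & Hx & Hxb) & Hmin); [definable_tac | |].
  - destruct (proj1 (proj1 Hw)) as (n & _ & Hn).
    destruct (H n Hn) as (m & x & y & a & b & _ & Hx & _ & _ & Hb & _).
    exists b. split; [exact (Hin n x b Hx Hb) | now exists n, x].
  - destruct (H n (function_domain Hf Hx)) as (m & x' & y & a & b' & _ & Hx' & Hy & Ha & Hb' & Hab).
    rewrite <- (function_unique Hf Hx Hx') in Hb'.
    rewrite <- (function_unique (Hfun x (HfX n x Hx)) Hxb Hb') in Hab.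
    apply (Hmin a); [exact (Hin m y a Hy Ha) | now exists m, y | exact Hab].
Qed.

End Rank.

(** * Exchanging two ultrafilters *)

(** k is the function t |-> G(t)(s), for a family G of functions indexed by Z. *)
Definition is_column (M : set_structure) (Z G s k : M) : Prop :=
  is_function_on k Z /\
  forall t a, related k t a <-> exists g, related G t g /\ related g s a.

Section Exchange.
Context {M : set_structure} (hZF : ZF M).

Lemma column_definable (Z : M) :
  definable 3 (fun e => is_column Z (e 0) (e 1) (e 2)).
Proof. unfold is_column. definable_tac. Qed.

Lemma column_exists (Y Z G s : M) : is_function_on G Z ->
  (forall t g, related G t g -> is_ordinal_function g Y) -> s ∈ Y ->
  exists k, is_column Z G s k /\ is_ordinal_function k Z.
Proof.
  intros HG HGo Hs.
  destruct (function_exists hZF (X := Z)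
    (Q := fun t a => exists g, related G t g /\ related g s a)) as (k & Hk & E);
    [definable_tac | |].
  - intros t Ht. destruct (function_total HG Ht) as [g Hg].
    destruct (function_total (proj1 (HGo t g Hg)) Hs) as [a Ha].
    exists a. split; [now exists g|]. intros b (g' & Hg' & Hb).
    rewrite <- (function_unique HG Hg Hg') in Hb.
    exact (function_unique (proj1 (HGo t g Hg)) Ha Hb).
  - exists k. split; [split; [exact Hk|]|split; [exact Hk|]].
    + intros t a. rewrite E. split; [tauto|]. intros (g & Hg & Ha).
      split; [exact (function_domain HG Hg) | now exists g].
    + intros t a H. apply E in H as (_ & g & Hg & Ha). exact (proj2 (HGo t g Hg) s a Ha).
Qed.

(** If h'(t) < h(t) <= rk_D(G(t)), some function below G(t) has rank at least
    h'(t).  Truncation confines the candidates to one set of functions, so that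
    choice on Z can select G'(t). *)
Lemma choose_smaller (D Y Z G h h' : M) : is_filter D Y -> AC_on Z ->
  is_function_on G Z -> (forall t g, related G t g -> is_ordinal_function g Y) ->
  is_ordinal_function h' Z ->
  exists G', is_function_on G' Z /\
    (forall t g, related G' t g -> is_ordinal_function g Y) /\
    (forall t g g' x y, related G t g -> related G' t g' -> related h t x ->
      related h' t y -> y ∈ x -> (forall c, c ∈ x -> ~ rank_le D Y g c) ->
      lt_mod D Y g' g /\ forall c, c ∈ y -> ~ rank_le D Y g' c).
Proof.
  intros F hAC HG HGo Hh'.
  assert (exists b, is_ordinal b /\ forall t g, related G t g -> maps_to g Y b)
    as (b & Hb & HGb).
  { destruct (range_exists hZF G) as [u Hu]. destruct (zf_union hZF u) as [q Hq].
    destruct (range_exists hZF q) as [v Hv]. destruct (ordinal_bound hZF v) as (b & Hb & H).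
    exists b. split; auto. intros t g Hg. split; [exact (proj1 (HGo t g Hg))|].
    intros s a Hs. apply H; [|exact (proj2 (HGo t g Hg) s a Hs)].
    apply (Hv s a). destruct Hs as (p & Hp & Hpg). exists p. split; [exact Hp|].
    apply Hq. exists g. split; [exact (proj2 (Hu t g Hg)) | exact Hpg]. }
  destruct (functions_exist hZF Y b) as [B HB].
  set (good := fun t g' => forall g x y, related G t g -> related h t x ->
    related h' t y -> y ∈ x -> (forall c, c ∈ x -> ~ rank_le D Y g c) ->
    lt_mod D Y g' g /\ forall c, c ∈ y -> ~ rank_le D Y g' c).
  assert (Hgood : definable 2 (fun e => good (e 0) (e 1)))
    by (unfold good; definable_tac).
  destruct (function_exists hZF (X := Z)
    (Q := fun t C => forall g, g ∈ C <-> g ∈ B /\ good t g)) as (C & HC & EC);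
    [definable_tac | |].
  { intros t _.
    destruct (separation hZF (P := good t) B) as [C HC]; [definable_tac|].
    exists C. split; [exact HC|]. intros C' HC'. apply (set_ext hZF). intros g.
    now rewrite (HC g), (HC' g). }
  destruct (hAC C HC) as (G' & HG' & HGC).
  { intros t A HA. apply EC in HA as [Ht HA].
    destruct (function_total HG Ht) as [g Hg].
    destruct (classic (exists x y, related h t x /\ related h' t y /\ y ∈ x /\
      forall c, c ∈ x -> ~ rank_le D Y g c)) as [(x & y & Hx & Hy & Hyx & HN)|N].
    - pose proof (proj2 Hh' t y Hy) as Oy. pose proof (HGo t g Hg) as Og.
      assert (exists k, is_ordinal_function k Y /\ lt_mod D Y k g /\
        forall c, c ∈ y -> ~ rank_le D Y k c) as (k & Hk & Hlt & HNk).
      { apply NNPP. intros N. apply (HN y Hyx). apply (rank_le_iff hZF F Og Oy).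
        intros k Hk Hlt. apply NNPP. intros N'. apply N. exists k.
        split; [exact Hk|]. split; [exact Hlt|]. intros c Hc K. apply N'. eauto. }
      destruct (lt_mod_truncate hZF F Hb (HGb t g Hg) (proj1 Hk) Hlt) as (k' & Hk' & He).
      pose proof (eq_lt_mod hZF F (proj1 Hk) He Hlt) as Hlt'.
      exists k'. apply HA. split; [now apply HB|].
      intros g1 x1 y1 Hg1 Hx1 Hy1 _ _.
      rewrite <- (function_unique HG Hg Hg1), <- (function_unique (proj1 Hh') Hy Hy1).
      split; [exact Hlt'|]. intros c Hc K. apply (HNk c Hc).
      exact (rank_le_eq_mod hZF F (maps_to_ordinal_function Hb Hk') Hk
        (ordinal_mem Oy Hc) He K).
    - exists g. apply HA. split; [apply HB; exact (HGb t g Hg)|].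
      intros g1 x y Hg1 Hx Hy Hyx HN. destruct N. exists x, y.
      rewrite (function_unique HG Hg Hg1). auto. }
  assert (HG'g : forall t g, related G' t g -> g ∈ B /\ good t g).
  { intros t g Hg. pose proof (function_domain HG' Hg) as Ht.
    destruct (function_total HC Ht) as [A HA].
    apply (proj1 (EC t A)) in HA as HA'. apply (proj2 HA'). exact (HGC t A g HA Hg). }
  exists G'. split; [exact HG'|]. split.
  - intros t g Hg. apply (maps_to_ordinal_function Hb). apply HB. now apply (HG'g t).
  - intros t g g' x y Hg Hg' Hx Hy Hyx HN. destruct (HG'g t g' Hg') as [_ K].
    exact (K g x y Hg Hx Hy Hyx HN).
Qed.

(** rk_E(h) <= rk_D(f) when h(t) <= rk_D(G(t)) for E-almost all t and f(s) bounds
    the rank modulo E of the s-th column of G for D-almost all s. *)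
Lemma rank_exchange (D Y E Z : M) : is_filter D Y -> is_ultrafilter E Z -> AC_on Z ->
  family_complete E Z Y -> forall xi, is_ordinal xi -> forall h G f,
  is_ordinal_function h Z -> is_function_on G Z ->
  (forall t g, related G t g -> is_ordinal_function g Y) -> is_ordinal_function f Y ->
  large E Z (fun t => forall g x, related G t g -> related h t x ->
    forall c, c ∈ x -> ~ rank_le D Y g c) ->
  large D Y (fun s => forall k x, is_column Z G s k -> related f s x -> rank_le E Z k x) ->
  rank_le D Y f xi -> rank_le E Z h xi.
Proof.
  intros F U hAC HE. pose proof (proj1 U) as FE. pose proof (column_definable Z) as Hcol.
  refine (ordinal_induction hZF (P := _) _ _); [definable_tac|].
  intros xi Hxi IH h G f Hh HG HGo Hf Hlow Hup Hfxi.
  apply (rank_le_iff hZF FE Hh Hxi). intros h' Hh' Hlt.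
  destruct (choose_smaller h F hAC HG HGo Hh') as (G' & HG' & HGo' & Hsm).
  (* Column s of G' is below column s of G at t. *)
  set (below := fun s t => exists g g' a b, related G t g /\ related G' t g' /\
    related g' s a /\ related g s b /\ a ∈ b).
  assert (Hbelow : definable 2 (fun e => below (e 0) (e 1)))
    by (unfold below; definable_tac).
  set (drop := fun t => (exists a b, related h' t a /\ related h t b /\ a ∈ b) /\
    forall g x, related G t g -> related h t x -> forall c, c ∈ x -> ~ rank_le D Y g c).
  assert (Hdrop : large E Z drop) by exact (large_and hZF FE Hlt Hlow).
  assert (Hdrop_low : forall t g', drop t -> related G' t g' ->
    large D Y (fun s => below s t) /\
    forall y c, related h' t y -> c ∈ y -> ~ rank_le D Y g' c).
  { intros t g' [(y & x & Hy & Hx & Hyx) Hd] Hg'.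
    destruct (function_total HG (function_domain HG' Hg')) as [g Hg].
    destruct (Hsm t g g' x y Hg Hg' Hx Hy Hyx (Hd g x Hg Hx)) as [Hlt' HN].
    split.
    - apply (large_mono hZF F) with (2 := Hlt'); [definable_tac|].
      intros s _ (a & b & Ha & Hb & Hab). now exists g, g', a, b.
    - intros y' c Hy' Hc. rewrite <- (function_unique (proj1 Hh') Hy Hy') in Hc. auto. }
  (* For E-almost all t, comparing the columns at t alone shows, for every s at once,
     whether column s decreases modulo E. *)
  assert (Hdecide : large E Z (fun t => forall s, s ∈ Y ->
    (large E Z (below s) <-> below s t))).
  { apply (HE (fun s t => large E Z (below s) <-> below s t)); [definable_tac|].
    intros s _. destruct (large_or_not hZF (P := below s) U) as [K|K]; [definable_tac| |].
    - apply (large_mono hZF FE) with (2 := K); [definable_tac|]. intros t _ Ht. tauto.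
    - apply (large_mono hZF FE) with (2 := K); [definable_tac|]. intros t _ Ht.
      split; [|tauto]. intros L. exfalso.
      destruct (large_inhabited FE (large_and hZF FE K L)) as (t' & _ & N & B). auto. }
  assert (Hbig : large D Y (fun s => large E Z (below s))).
  { destruct (large_inhabited FE (large_and hZF FE Hdrop Hdecide)) as (t & Ht & Hd & K).
    destruct (function_total HG' Ht) as [g' Hg'].
    destruct (Hdrop_low t g' Hd Hg') as [L _].
    apply (large_mono hZF F) with (2 := L); [definable_tac|].
    intros s Hs B. now apply (K s Hs). }
  set (bounds := fun s c => forall k, is_column Z G' s k -> rank_le E Z k c).
  assert (Hbounds : definable 2 (fun e => bounds (e 0) (e 1)))
    by (unfold bounds; definable_tac).
  assert (Hcolumn : large D Y (fun s => exists x c, related f s x /\ c ∈ x /\ bounds s c)).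
  { apply (large_mono2 hZF F) with (2 := Hbig) (3 := Hup); [definable_tac|].
    intros s Hs HL HU.
    destruct (function_total (proj1 Hf) Hs) as [x Hx].
    destruct (column_exists HG HGo Hs) as (k & Hk & Ok).
    destruct (column_exists HG' HGo' Hs) as (k' & Hk' & Ok').
    pose proof (HU k x Hk Hx) as Hkx. pose proof (proj2 Hf s x Hx) as Ox.
    destruct (proj1 (rank_le_iff hZF FE Ok Ox) Hkx k' Ok') as (c & Hc & Hkc).
    - apply (large_mono hZF FE) with (2 := HL); [definable_tac|].
      intros t _ (g & g' & a & b & Hg & Hg' & Ha & Hb & Hab). exists a, b.
      split; [apply (proj2 Hk'); now exists g'|].
      split; [apply (proj2 Hk); now exists g | exact Hab].
    - exists x, c. split; [exact Hx|]. split; [exact Hc|]. intros k1 Hk1.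
      rewrite (function_ext hZF (proj1 Hk1) (proj1 Hk')); [exact Hkc|].
      intros t a. now rewrite (proj2 Hk1 t a), (proj2 Hk' t a). }
  (* f'(s) is the least bound for the new column; the alternative c = x is a default
     that makes f' total. *)
  destruct (function_exists hZF (X := Y) (Q := fun s c => exists x, related f s x /\
    is_ordinal c /\
    (c = x \/ bounds s c) /\ forall d, d ∈ c -> ~ (d = x \/ bounds s d))) as (f' & Hf' & Ef');
    [definable_tac | |].
  { intros s Hs. destruct (function_total (proj1 Hf) Hs) as [x Hx].
    pose proof (proj2 Hf s x Hx) as Ox.
    destruct (ordinal_least hZF (P := fun c => c = x \/ bounds s c)) with (a := x)
      as (c & Oc & Pc & Hmin & _); [definable_tac | exact Ox | now left |].
    exists c. split; [now exists x|]. intros d (x' & Hx' & Od & Pd & Hmin').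
    rewrite <- (function_unique (proj1 Hf) Hx Hx') in *.
    destruct (ordinal_total hZF Oc Od) as [K|[K|K]]; auto; exfalso.
    - exact (Hmin' c K Pc).
    - exact (Hmin d K Pd). }
  assert (Of' : is_ordinal_function f' Y).
  { split; [exact Hf'|]. intros s c Hc. apply Ef' in Hc as (_ & x & _ & Oc & _). exact Oc. }
  assert (Hf'val : forall s x c d, related f s x -> related f' s d -> c ∈ x ->
    bounds s c -> d ∈ x /\ bounds s d).
  { intros s x c d Hx Hd Hc Hb. apply Ef' in Hd as (_ & x' & Hx' & Od & Pd & Hmin).
    rewrite <- (function_unique (proj1 Hf) Hx Hx') in *.
    pose proof (proj2 Hf s x Hx) as Ox. pose proof (ordinal_mem Ox Hc) as Oc.
    assert (Hdc : d ⊆ c).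
    { apply (ordinal_not_mem hZF Oc Od). intros K. apply (Hmin c K). now right. }
    pose proof (ordinal_subset_mem hZF Od Oc Ox Hdc Hc) as Hdx. split; [exact Hdx|].
    destruct Pd as [->|Pd]; [destruct (mem_irrefl hZF Hdx) | exact Pd]. }
  destruct (proj1 (rank_le_iff hZF F Hf Hxi) Hfxi f' Of') as (xi' & Hxi' & Hf'xi).
  { apply (large_mono hZF F) with (2 := Hcolumn); [definable_tac|].
    intros s Hs (x & c & Hx & Hc & Hb). destruct (function_total Hf' Hs) as [d Hd].
    exists d, x. split; [exact Hd|]. split; [exact Hx|]. now apply (Hf'val s x c d). }
  exists xi'. split; [exact Hxi'|].
  apply (IH xi' Hxi' h' G' f' Hh' HG' HGo' Of'); [| |exact Hf'xi].
  - apply (large_mono hZF FE) with (2 := Hdrop); [definable_tac|].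
    intros t _ Hd g y Hg Hy c Hc. exact (proj2 (Hdrop_low t g Hd Hg) y c Hy Hc).
  - apply (large_mono hZF F) with (2 := Hcolumn).
    { definable_tac. }
    intros s Hs (x & c & Hx & Hc & Hb) k d Hk Hd.
    now apply (Hf'val s x c d Hx Hd Hc Hb).
Qed.

End Exchange.

(** * Ordinals fixed by all sufficiently complete ultrafilters *)

Section Fixed.
Context {M : set_structure} (hZF : ZF M).

(** The exchange inequality for the constant family g, whose s-th column is the
    constant g(s). *)
Lemma constant_rank_transfer (D Y E Z g z c : M) : is_filter D Y -> is_ultrafilter E Z ->
  AC_on Z -> family_complete E Z Y -> is_ordinal z -> is_ordinal_function g Y ->
  (forall b, b ∈ z -> ~ rank_le D Y g b) -> rank_le D Y g z ->
  large D Y (fun s => forall x d, related g s x -> is_constant d Z x -> rank_le E Z d x) ->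
  is_constant c Z z -> rank_le E Z c z.
Proof.
  intros F U hAC HE Hz Hg Hlow Hgz HL Hc.
  pose proof (column_definable hZF Z) as Hcol.
  destruct (constant_exists hZF Z g) as [G HG].
  assert (HGg : forall t g', related G t g' -> g' = g).
  { intros t g' Hg'.
    exact (function_unique (proj1 HG) Hg' (proj2 HG t (function_domain (proj1 HG) Hg'))). }
  refine (@rank_exchange M hZF D Y E Z F U hAC HE z Hz c G g
    (constant_ordinal_function Hz Hc) (proj1 HG) _ Hg _ _ Hgz).
  - intros t g' Hg'. now rewrite (HGg t g' Hg').
  - apply (large_always (proj1 U)). intros t Ht g' x Hg' Hx d Hd.
    rewrite (HGg t g' Hg'). apply Hlow.
    now rewrite <- (function_unique (proj1 Hc) Hx (proj2 Hc t Ht)).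
  - apply (large_mono hZF F) with (2 := HL); [definable_tac|].
    intros s _ K k x Hk Hx. apply K; [exact Hx|]. split; [exact (proj1 Hk)|].
    intros t Ht. apply (proj2 Hk). exists g. split; [exact (proj2 HG t Ht) | exact Hx].
Qed.

(** A <_D-minimal function among those below the constant z of rank at least z has
    rank exactly z. *)
Lemma rank_equal_exists (D Y w z c : M) : DC M -> is_filter D Y -> is_omega w ->
  family_complete D Y w -> is_ordinal z -> is_constant c Y z -> ~ rank_le D Y c z ->
  exists g, is_ordinal_function g Y /\ lt_mod D Y g c /\
    (forall b, b ∈ z -> ~ rank_le D Y g b) /\ rank_le D Y g z.
Proof.
  intros hDC F Hw HD Hz Hc N.
  pose proof (constant_ordinal_function Hz Hc) as Oc.
  destruct (ordinal_function_bound hZF Oc) as (b & Hb & Hcb).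
  destruct (functions_exist hZF Y b) as [B HB].
  destruct (separation hZF (P := fun g => lt_mod D Y g c /\
    forall a, a ∈ z -> ~ rank_le D Y g a) B) as [X HX]; [definable_tac|].
  assert (HXo : forall g, g ∈ X -> is_ordinal_function g Y).
  { intros g Hg. apply HX in Hg as [Hg _]. apply HB in Hg.
    exact (maps_to_ordinal_function Hb Hg). }
  assert (HXin : forall h, is_ordinal_function h Y -> lt_mod D Y h c ->
    (forall a, a ∈ z -> ~ rank_le D Y h a) -> exists h', h' ∈ X /\ eq_mod D Y h' h).
  { intros h Hh Hlt Hlow.
    destruct (lt_mod_truncate hZF F Hb Hcb (proj1 Hh) Hlt) as (h' & Hh' & He).
    exists h'. split; [|exact He]. apply HX. split; [now apply HB|].
    split; [exact (eq_lt_mod hZF F (proj1 Hh) He Hlt)|].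
    intros a Ha K. apply (Hlow a Ha).
    exact (rank_le_eq_mod hZF F (maps_to_ordinal_function Hb Hh') Hh
      (ordinal_mem Hz Ha) He K). }
  destruct (lt_mod_minimal hZF (X := X) hDC F Hw HD) as (g & Hg & Hmin).
  - apply NNPP. intros N'. apply N. apply (rank_le_iff hZF F Oc Hz). intros h Hh Hlt.
    apply NNPP. intros N''. destruct (HXin h Hh Hlt) as (h' & Hh' & _).
    + intros a Ha K. apply N''. now exists a.
    + apply N'. now exists h'.
  - intros g Hg. exact (proj1 (HXo g Hg)).
  - pose proof (HXo g Hg) as Og. pose proof (proj1 (HX g) Hg) as (_ & Hgc & Hlow).
    exists g. split; [exact Og|]. split; [exact Hgc|]. split; [exact Hlow|].
    apply (rank_le_iff hZF F Og Hz). intros h Hh Hlt. apply NNPP. intros N'.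
    destruct (HXin h Hh (lt_mod_trans hZF F (proj1 Og) Oc Hlt Hgc)) as (h' & Hh' & He).
    + intros a Ha K. apply N'. now exists a.
    + exact (Hmin h' Hh' (eq_lt_mod hZF F (proj1 Hh) He Hlt)).
Qed.

End Fixed.

Theorem mainTheorem1 (M : set_structure) (hZF : ZF M) (hDC : DC M)
    (mu : M) (hAC : AC_below mu) (hsing : is_singular mu)
    (hsup : is_sup mu (fun lambda : M => mem lambda mu /\ is_measurable lambda))
    (zeta : M) (hzeta : is_ordinal zeta) :
  exists kappa : M, mem kappa mu /\ is_cardinal kappa /\
    forall theta D : M, mem theta mu -> is_cardinal theta ->
      is_ultrafilter D theta -> is_complete kappa D theta ->
      rank_const_is D theta zeta zeta.
Proof.
  destruct hsup as (Omu & _ & Hleast).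
  destruct hsing as (_ & _ & cf & p & Hcf & [Hp Hpmu] & Hcofinal).
  set (works := fun z k => forall theta D, theta ∈ mu -> is_cardinal theta ->
    is_ultrafilter D theta -> is_complete k D theta ->
    forall c, is_constant c theta z -> rank_le D theta c z).
  assert (Hworks : definable 2 (fun e => works (e 0) (e 1)))
    by (unfold works; definable_tac).
  assert (Hmono : forall z k l, k ⊆ l -> works z k -> works z l).
  { intros z k l Hkl W theta D Ht Ct U Hl. apply (W theta D Ht Ct U).
    intros S b C HS Hb. apply (Hl S b C HS). now apply Hkl. }
  assert (Hbig : forall x y, x ∈ mu -> y ∈ mu -> exists l w, l ∈ mu /\ is_cardinal l /\
    is_omega w /\ w ∈ l /\ x ∈ l /\ y ∈ l).
  { assert (A : forall x, x ∈ mu -> exists l, l ∈ mu /\ is_measurable l /\ x ∈ l).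
    { intros x Hx. apply NNPP. intros N. apply (mem_irrefl hZF (x := x)).
      apply (Hleast x (ordinal_mem Omu Hx)); [|exact Hx]. intros l [Hl Ml].
      apply (ordinal_not_mem hZF (ordinal_mem Omu Hx) (ordinal_mem Omu Hl)).
      intros K. apply N. now exists l. }
    assert (A' : forall x y, x ∈ mu -> y ∈ mu ->
      exists l, l ∈ mu /\ is_measurable l /\ x ∈ l /\ y ∈ l).
    { intros x y Hx Hy. destruct (A x Hx) as (l & Hl & Ml & Hxl).
      destruct (A y Hy) as (k & Hk & Mk & Hyk).
      pose proof (ordinal_mem Omu Hl) as Ol. pose proof (ordinal_mem Omu Hk) as Ok.
      destruct (ordinal_total hZF Ol Ok) as [K|[K|K]].
      - exists k. pose proof (ordinal_trans Ok Hxl K). auto.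
      - subst k. exists l. auto.
      - exists l. pose proof (ordinal_trans Ol Hyk K). auto. }
    intros x y Hx Hy. destruct (A' x y Hx Hy) as (l & Hl & (Cl & (w & Hw & Hwl) & _) & Hxl & Hyl).
    exists l, w. auto 6. }
  assert (Hall : exists k, k ∈ mu /\ is_cardinal k /\ works zeta k).
  { revert zeta hzeta.
    apply (ordinal_induction hZF (P := fun z => exists k, k ∈ mu /\ is_cardinal k /\ works z k));
      [definable_tac|].
    intros z Hz IH. apply NNPP. intros N.
    assert (Hbad : forall k, k ∈ mu -> is_cardinal k -> exists theta D c, theta ∈ mu /\
      is_cardinal theta /\ is_ultrafilter D theta /\ is_complete k D theta /\
      is_constant c theta z /\ ~ rank_le D theta c z).
    { intros k Hk Ck. apply NNPP. intros N'. apply N. exists k. split; [exact Hk|].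
      split; [exact Ck|]. intros theta D Ht Ct U Hc c Hcc. apply NNPP. intros N''.
      apply N'. exists theta, D, c. auto 7. }
    destruct (Hbig cf cf Hcf Hcf) as (k & w & Hk & Ck & Hw & Hwk & Hcfk & _).
    destruct (Hbad k Hk Ck) as (Y & D & c & HY & CY & UD & HcD & Hc & Nc).
    pose proof (proj1 UD) as F. pose proof (ordinal_mem Omu Hk) as Ok.
    pose proof (complete_family_complete hZF Ok Hwk HcD) as HDw.
    pose proof (complete_family_complete hZF Ok Hcfk HcD) as HDcf.
    destruct (rank_equal_exists hZF hDC F Hw HDw Hz Hc Nc) as (g & Og & Hgc & Hlow & Hgz).
    (* The i-th value of the cofinal sequence bounds a witness for g(s). *)
  set (covers := fun i s => exists x k, related g s x /\ works x k /\
      exists l, related p i l /\ k ⊆ l).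
    assert (Hcovers : definable 2 (fun e => covers (e 0) (e 1)))
      by (unfold covers; definable_tac).
    assert (Hpiece : exists i, i ∈ cf /\ large D Y (covers i)).
    { apply NNPP. intros N'.
      assert (L : large D Y (fun s => forall i, i ∈ cf -> ~ covers i s)).
      { apply (HDcf (fun i s => ~ covers i s)); [definable_tac|]. intros i Hi.
        destruct (large_or_not hZF (P := covers i) UD) as [K|K]; [definable_tac| |exact K].
        destruct N'. now exists i. }
      destruct (large_inhabited F (large_and hZF F Hgc L)) as (s & Hs & (x & z' & Hx & Hz' & Hxz) & K).
      rewrite (function_unique (proj1 Hc) Hz' (proj2 Hc s Hs)) in Hxz.
      destruct (IH x Hxz) as (kx & Hkx & _ & Wx).
      destruct (Hcofinal kx Hkx) as (i & l & Hil & Hkl).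
      apply (K i (function_domain Hp Hil)). exists x, kx. eauto. }
    destruct Hpiece as (i & Hi & HL).
    destruct (function_total Hp Hi) as [l Hl].
    destruct (Hbig Y l HY (Hpmu i l Hl)) as (m & _ & Hm & Cm & _ & _ & HYm & Hlm).
    destruct (Hbad m Hm Cm) as (Z & E & d & HZ & CZ & UE & HmE & Hd & Nd).
    apply Nd. pose proof (ordinal_mem Omu Hm) as Om.
    apply (constant_rank_transfer hZF (D := D) (Y := Y) (g := g) F UE (hAC Z HZ)
      (complete_family_complete hZF Om HYm HmE) Hz Og Hlow Hgz); [|exact Hd].
    apply (large_mono hZF F) with (2 := HL); [definable_tac|].
    intros s Hs (x & kx & Hx & Wx & l' & Hl' & Hkl) x' d' Hx' Hd'.
    rewrite <- (function_unique (proj1 Og) Hx Hx') in *.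
    rewrite <- (function_unique Hp Hl Hl') in Hkl.
    apply (Hmono x kx m) with (theta := Z) (D := E); auto.
    intros t Ht. exact (ordinal_trans Om (Hkl t Ht) Hlm). }
  destruct Hall as (k & Hk & Ck & W). exists k. split; [exact Hk|]. split; [exact Ck|].
  intros theta D Ht Ct U Hc. destruct (constant_exists hZF theta zeta) as [c Hcc].
  exact (rank_const_intro hZF (proj1 U) hzeta Hcc (W theta D Ht Ct U Hc c Hcc)).
Qed.
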